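(* Let $H\in(1/4,1)$ and let $V_1,\dots,V_d$ be $C^\infty$-bounded vector fields on $\mathbb{R}^N$ such that, with $V(x)$ denoting the $N\times d$ matrix with columns $V_1(x),\dots,V_d(x)$, there are constants $\Lambda_1,\Lambda_2>0$ with $$\Lambda_1|\xi|^2\le \xi^*V(x)V(x)^*\xi\le\Lambda_2|\xi|^2\qquad\text{for all }x,\xi\in\mathbb{R}^N.$$ Let $d(x,y)$ be the control distance function $$d(x,y)=\inf\{\|h\|_{\bar{\mathcal H}}:\ h\in\bar{\mathcal H},\ \Phi_1(x;h)=y\},$$ where $\bar{\mathcal H}$ is the Cameron–Martin space of $d$-dimensional fractional Brownian motion on $[0,1]$ with Hurst parameter $H$, and $\Phi_t(x;h)$ is the solution at time $t$ of $d\Phi_t=\sum_{i=1}^dV_i(\Phi_t)\,dh^i_t$, $\Phi_0=x$. Then there exist constants $C,\delta>0$ such that $$\frac1C|x-y|\le d(x,y)\le C|x-y|$$ for all $x,y\in\mathbb{R}^N$ with $|x-y|<\delta$.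
   Context: ''$C^\infty$-bounded'' means smooth and bounded together with all derivatives; $(\cdot)^*$ denotes matrix transpose. Fractional Brownian motion: the $d$-dimensional fractional Brownian motion $B=(B^1,\dots,B^d)$ with Hurst parameter $H$ is the continuous centered Gaussian process with $\mathbb{E}[B^i_sB^j_t]=\frac12(s^{2H}+t^{2H}-|s-t|^{2H})\delta_{ij}$. Cameron–Martin space: for $d=1$, let $\mathcal C_1$ be the closed linear span of $\{B_t:0\le t\le1\}$ in $L^2(\mathbb P)$. Then $\bar{\mathcal H}$ is the set of paths $h:[0,1]\to\mathbb{R}$ of the form $h_t=\mathbb{E}[B_tZ]$ with $Z\in\mathcal C_1$, with inner product $\langle h_1,h_2\rangle_{\bar{\mathcal H}}=\mathbb{E}[Z_1Z_2]$ when $h_i$ corresponds to $Z_i$. For general $d$ the space is the $d$-fold Hilbert direct sum (componentwise definition). It is known that elements of $\bar{\mathcal H}$ are $H$-Hölder continuous if $H>1/2$, and have finite $q$-variation for every $q>(H+1/2)^{-1}$ if $H\le1/2$, with continuous embeddings; hence for $H>1/4$ the equation defining $\Phi$ is a well-posed ordinary differential equation in Young's sense. *)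

(* Defs.v *)
From HB Require Import structures.
From mathcomp Require Import all_boot all_order all_algebra.
From mathcomp Require Import all_classical all_reals all_analysis.

Set Implicit Arguments.
Unset Strict Implicit.
Unset Printing Implicit Defensive.

Import Order.TTheory GRing.Theory Num.Theory.
Import numFieldNormedType.Exports.

Local Open Scope classical_set_scope.
Local Open Scope ring_scope.

(* The library norm on matrices is the sup norm, hence the Euclidean norm. *)
Definition enorm (R : realType) (N : nat) (v : 'cV[R]_N) : R :=
  Num.sqrt (\sum_(k < N) v k 0 ^+ 2).

Section VectorFields.
Context (R : realType) (N : nat).

Fixpoint iter_partial (s : seq 'I_N) (W : 'cV[R]_N -> 'cV[R]_N) :
    'cV[R]_N -> 'cV[R]_N :=
  if s is i :: s' then
    fun x => 'D_(delta_mx i 0) (iter_partial s' W) x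
  else W.

Definition smooth_bounded (W : 'cV[R]_N -> 'cV[R]_N) : Prop :=
  forall s : seq 'I_N,
    [/\ (forall x i, derivable (iter_partial s W) x (delta_mx i 0)),
        continuous (iter_partial s W) &
        exists M : R, forall x, enorm (iter_partial s W x) <= M].

Definition field_matrix (d : nat) (V : 'I_d -> 'cV[R]_N -> 'cV[R]_N)
    (x : 'cV[R]_N) : 'M[R]_(N, d) :=
  \matrix_(k < N, i < d) V i x k 0.

End VectorFields.

Section FractionalBrownianMotion.
Context (disp : measure_display) (T : measurableType disp) (R : realType).
Context (P : probability T R).

(* [normal_prob m 0] is by convention the uniform law on [0, 1], so the
   degenerate Gaussian law has to be treated apart. *)
Definition gaussian (X : {mfun T >-> R}) : Prop :=
  exists m s : R, forall A : set R, measurable A ->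
    distribution P X A = if s == 0 then \d_m A else normal_prob m s A.

Definition is_fBm (d : nat) (H : R) (B : 'I_d -> R -> {mfun T >-> R}) : Prop :=
  [/\ (forall n (c : 'I_n -> R) (i : 'I_n -> 'I_d) (t : 'I_n -> R),
         (forall k, t k \in `[0, 1]) ->
         gaussian (\sum_(k < n) c k *: B (i k) (t k))),
      (forall i t, t \in `[0, 1] -> 'E_P[B i t]%E = 0%E),
      (forall i j s t, s \in `[0, 1] -> t \in `[0, 1] ->
         'E_P[B i s \* B j t]%E =
         (2^-1 * (s `^ (2 * H) + t `^ (2 * H) - `|s - t| `^ (2 * H))
          * (i == j)%:R)%:E) &
      forall i w, {within `[0, 1], continuous (fun t : R => B i t w)}].

(* Representatives of the elements of the closed linear span in L^2. *)
Definition L2_span (B : R -> {mfun T >-> R}) : set {mfun T >-> R} :=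
  [set Z : {mfun T >-> R} | ((Z : T -> R) \in Lfun P 2%:E) /\
    forall e : R, 0 < e ->
      exists n (c : 'I_n -> R) (t : 'I_n -> R),
        (forall k, t k \in `[0, 1]) /\
        ('N[P]_(2%:E)[EFin \o (Z \- (\sum_(k < n) c k *: B (t k) : {mfun T >-> R}))%R] < e%:E)%E].

(* Paths on [0, 1] are functions R -> R, whose values outside [0, 1] are
   never used. *)
Definition cm_represents (B : R -> {mfun T >-> R}) (h : R -> R)
    (Z : {mfun T >-> R}) : Prop :=
  L2_span B Z /\ forall t, t \in `[0, 1] -> (h t)%:E = 'E_P[B t \* Z]%E.

Definition cm_space1 (B : R -> {mfun T >-> R}) : set (R -> R) :=
  [set h | exists Z, cm_represents B h Z].

(* The representing variable is unique up to P-null sets. *)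
Definition cm_rep (B : R -> {mfun T >-> R}) (h : R -> R) : {mfun T >-> R} :=
  xget (cst 0 : {mfun T >-> R}) [set Z | cm_represents B h Z].

Definition cm_inner1 (B : R -> {mfun T >-> R}) (h1 h2 : R -> R) : R :=
  fine 'E_P[cm_rep B h1 \* cm_rep B h2]%E.

Definition cm_space (d : nat) (B : 'I_d -> R -> {mfun T >-> R}) :
    set ('I_d -> R -> R) :=
  [set h | forall i, cm_space1 (B i) (h i)].

Definition cm_inner (d : nat) (B : 'I_d -> R -> {mfun T >-> R})
    (h1 h2 : 'I_d -> R -> R) : R :=
  \sum_(i < d) cm_inner1 (B i) (h1 i) (h2 i).

Definition cm_norm (d : nat) (B : 'I_d -> R -> {mfun T >-> R})
    (h : 'I_d -> R -> R) : R :=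
  Num.sqrt (cm_inner B h h).

End FractionalBrownianMotion.

Section YoungEquations.
Context (R : realType).

(* A partition a = t_0 < t_1 < ... < t_n = b is given by s = [t_1; ...; t_n]. *)
Definition finite_variation (U : normedModType R) (p a b : R) (f : R -> U) :
    Prop :=
  exists M : R, forall s, itv_partition a b s ->
    \sum_(0 <= k < size s)
      `|f (nth b (a :: s) k.+1) - f (nth b (a :: s) k)| `^ p <= M.

Definition riemann_sum (U : normedModType R) (f : R -> U) (g : R -> R)
    (a b : R) (s : seq R) (xi : nat -> R) : U :=
  \sum_(0 <= k < size s)
    (g (nth b (a :: s) k.+1) - g (nth b (a :: s) k)) *: f (xi k).

(* I is the integral of f against g over [a, b], in Young's sense. *)
Definition is_young_integral (U : normedModType R) (f : R -> U) (g : R -> R)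
    (a b : R) (I : U) : Prop :=
  [/\ {within `[a, b], continuous f},
      {within `[a, b], continuous g},
      (exists p q : R, [/\ 1 <= p, 1 <= q, 1 < p^-1 + q^-1,
         finite_variation p a b f & finite_variation q a b g]) &
      forall e : R, 0 < e -> exists2 delta : R, 0 < delta &
        forall (s : seq R) (xi : nat -> R), itv_partition a b s ->
          (forall k, (k < size s)%N ->
             nth b (a :: s) k.+1 - nth b (a :: s) k < delta /\
             nth b (a :: s) k <= xi k <= nth b (a :: s) k.+1) ->
          `|riemann_sum f g a b s xi - I| < e].

(* Solutions are sought among the continuous paths of finite p-variation for
   some p < 2, where they are unique if the driver is of the same kind. *)
Definition is_young_solution (N d : nat) (V : 'I_d -> 'cV[R]_N -> 'cV[R]_N)
    (h : 'I_d -> R -> R) (x : 'cV[R]_N) (phi : R -> 'cV[R]_N) : Prop :=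
  [/\ phi 0 = x,
      {within `[0, 1], continuous phi},
      (exists p : R, 1 <= p < 2 /\ finite_variation p 0 1 phi) &
      forall t, t \in `[0, 1] ->
        exists I : 'I_d -> 'cV[R]_N,
          (forall i, is_young_integral (fun s => V i (phi s)) (h i) 0 t (I i))
          /\ phi t = x + \sum_(i < d) I i].

End YoungEquations.

(* The infimum is taken in the extended reals: it is +oo if no h leads from x
   to y. *)
Definition control_distance (disp : measure_display) (T : measurableType disp)
    (R : realType) (P : probability T R) (N d : nat)
    (B : 'I_d -> R -> {mfun T >-> R}) (V : 'I_d -> 'cV[R]_N -> 'cV[R]_N)
    (x y : 'cV[R]_N) : \bar R :=
  ereal_inf [set (cm_norm P B h)%:E | h in
    [set h | cm_space P B h /\ exists phi, is_young_solution V h x phi /\ phi 1 = y]].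

(* Main.v *)
Require Import Defs.
From HB Require Import structures.
From mathcomp Require Import all_boot all_order all_algebra.
From mathcomp Require Import all_classical all_reals all_analysis.
From mathcomp Require Import ring lra zify.
Set Implicit Arguments.
Unset Strict Implicit.
Unset Printing Implicit Defensive.

Import Order.TTheory GRing.Theory Num.Theory.
Import numFieldNormedType.Exports.
Local Open Scope classical_set_scope.
Local Open Scope ring_scope.

(* Lower bound.  A Cameron-Martin path [h_t = E(B_t Z)] has finite q-variation
   for some q < 2, bounded by the norm of [Z].  For H > 1/2 it is H-Hoelder.  For
   H <= 1/2 the increments [X_k] of B over a partition of [0, 1] are negatively
   correlated, while each of them is nonnegatively correlated with their sum;
   hence [E (sum b_k X_k)^2 <= 2 sum b_k^2 D_k^(2H)] where [D_k] is the length of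
   the k-th interval, dually [sum h_k^2 / D_k^(2H) <= 2 E Z^2] for the increments
   [h_k] of h, and q = 2 / (1 + 2H) is admissible.  Young's estimate turns this
   into [|phi_1 - phi_0| <= K |h|] as soon as |h| is small.

   Upper bound.  Since all paths [t |-> a_i E(B_t B_1)] belong to the
   Cameron-Martin space, it is enough to steer with [h = a g], g being the
   increasing function [g t = E(B_t B_1)]: the solution is then the flow of
   the field [sum a_i V_i] at time [g t].  As [V(x)] has a right inverse bounded
   in terms of the ellipticity constant, x can be steered to y with |a| of the
   order of |x - y|. *)

(** * Young sums *)

(** Smallness of |h| is forced by the Young remainder: it is linear in the constant being estimated
    and can be absorbed only when its coefficient is at most 1/2. Nothing is lost, since a path with
    |h| >= eps satisfies the lower bound as soon as |x - y| < eps. The norm of h is read off a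
    representative picked by [xget], about which only membership in the L^2 span and the values
    E(B_t Z) are known. Two variables with the same values are compared by orthogonal projection,
    which is how the norm of [a g] gets bounded. The path E(B_t B_1) is increasing whatever H is, so
    that composing a Lipschitz function with it gives a path of bounded variation, and a Young
    equation driven by it is a time-changed autonomous equation. Steering becomes a boundary value
    problem with unknown parameter b. In the coordinates given by the right inverse of V(x) its
    endpoint is x + b to first order, so the identity can replace the derivative in Newton's method.
    Analytic estimates use the sup norm; the passage to [enorm] costs factors N. *)

Definition control (R : realType) (a b : R) (w : R -> R -> R) : Prop :=
  (forall s t, a <= s -> s <= t -> t <= b -> 0 <= w s t) /\
  (forall s u t, a <= s -> s <= u -> u <= t -> t <= b -> w s u + w u t <= w s t).

(** The solution of c = 2 * 2^(-theta) * c + 2: two pieces of at most half the mass, plus two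
    defects, one for each of the two cut points k and k + 1. *)
Definition sewing_cst (R : realType) (theta : R) : R :=
  2 / (1 - 2 `^ (1 - theta)).

Lemma sewing_denominator_gt0 (R : realType) (theta : R) :
  1 < theta -> 0 < 1 - 2 `^ (1 - theta) :> R.
Proof.
move=> t1; rewrite subr_gt0 /powR pnatr_eq0/= expR_lt1.
have l2 : 0 < ln 2 :> R by rewrite ln_gt0// ltr1n.
by rewrite pmulr_llt0 ?subr_lt0.
Qed.

(* Cutting [m, n] where the control reaches half of its total mass leaves two
   pieces of at most half the mass each, and 2 * 2^-theta < 1 absorbs them. *)
Lemma discrete_sewing (R : realType) (U : normedModType R) (m n : nat)
    (A : nat -> nat -> U) (w : nat -> nat -> R) (K theta : R) :
  1 < theta -> 0 <= K ->
  (forall i j, (m <= i)%N -> (i <= j)%N -> (j <= n)%N -> 0 <= w i j) ->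
  (forall i k j, (m <= i)%N -> (i <= k)%N -> (k <= j)%N -> (j <= n)%N ->
     w i k + w k j <= w i j) ->
  (forall i, A i i = 0) ->
  (forall i k j, (m <= i)%N -> (i <= k)%N -> (k <= j)%N -> (j <= n)%N ->
     `|A i j - A i k - A k j| <= K * w i j `^ theta) ->
  forall i j, (m <= i)%N -> (i <= j)%N -> (j <= n)%N ->
    `|\sum_(i <= k < j) A k k.+1 - A i j|
      <= sewing_cst theta * K * w i j `^ theta.
Proof.
move=> th1 K0 w0 wD A0 dA.
have th0 : 0 <= theta by lra.
set C := sewing_cst theta * K.
have D0 := sewing_denominator_gt0 th1.
have C0 : 0 <= C by rewrite mulr_ge0// divr_ge0// ltW.
have CE : C * (2 * 2 `^ (- theta)) + 2 * K = C.
  have -> : 2 * 2 `^ (- theta) = 2 `^ (1 - theta) :> R.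
    by rewrite powRD ?pnatr_eq0 ?implybT// powRr1.
  by rewrite /C /sewing_cst; field; rewrite gt_eqF.
have wS i j k l : (m <= i)%N -> (i <= k)%N -> (k <= l)%N -> (l <= j)%N ->
    (j <= n)%N -> w k l <= w i j.
  move=> mi ik kl lj jn.
  have h1 := wD i k j mi ik (leq_trans kl lj) jn.
  have h2 := wD k l j (leq_trans mi ik) kl lj jn.
  have h3 := w0 i k mi ik (leq_trans kl (leq_trans lj jn)).
  have h4 := w0 l j (leq_trans mi (leq_trans ik kl)) lj jn.
  lra.
have wii i : (m <= i)%N -> (i <= n)%N -> w i i = 0.
  move=> mi i_n; apply/eqP; rewrite eq_le w0// andbT.
  by have := wD i i i mi (leqnn _) (leqnn _) i_n; lra.
have half x y : 0 <= x -> 0 <= y -> x <= y / 2 ->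
    x `^ theta <= 2 `^ (- theta) * y `^ theta.
  move=> x0 y0 xy; rewrite powRN -powR_inv1 ?powR_ge0// powRAC -powRM ?powR_ge0//.
  by rewrite powR_inv1// ge0_ler_powR ?nnegrE ?mulr_ge0// mulrC.
suff main (l : nat) : forall i j, (j - i <= l)%N -> (m <= i)%N -> (i <= j)%N ->
    (j <= n)%N -> `|\sum_(i <= k < j) A k k.+1 - A i j| <= C * w i j `^ theta.
  by move=> i j; apply: main (leqnn _).
elim: l => [|l IH] i j jil mi ij jn.
  have -> : j = i by lia.
  by rewrite big_geq// A0 subrr normr0 mulr_ge0// powR_ge0.
have [->|inj] := eqVneq i j.
  by rewrite big_geq// A0 subrr normr0 mulr_ge0// powR_ge0.
have iltj : (i < j)%N by rewrite ltn_neqAle inj.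
(* With the largest such [d], the piece [i, k] has at most half the mass and [i, k + 1] has more, so
   superadditivity leaves at most half for [k + 1, j]. The single step [k, k + 1] in between carries
   no error. *)
pose Q (d : nat) := (i + d < j)%N && (w i (i + d)%N <= w i j / 2).
have exQ : exists d, Q d.
  exists 0%N; rewrite /Q addn0 iltj wii ?divr_ge0 ?w0//.
  exact: leq_trans ij jn.
have ubQ d : Q d -> (d <= j)%N by case/andP; lia.
have [d /andP[dj wd] dmax] := ex_maxnP exQ ubQ.
set k := (i + d)%N in dj wd.
have wk1 : w k.+1 j <= w i j / 2.
  have [kj|kj] := eqVneq k.+1 j.
    by rewrite kj wii ?divr_ge0 ?w0// (leq_trans mi).
  have : ~~ Q d.+1 by apply: contraTN (ltnSn d) => /dmax; rewrite -leqNgt.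
  rewrite /Q addnS ltn_neqAle kj/= dj/= -ltNge => h.
  by have := wD i k.+1 j mi (leqW (leq_addr _ _)) dj jn; lra.
have ik : (i <= k)%N by rewrite leq_addr.
have h1 : `|\sum_(i <= r < k) A r r.+1 - A i k| <= C * w i k `^ theta.
  by apply: IH => //; lia.
have h2 : `|\sum_(k.+1 <= r < j) A r r.+1 - A k.+1 j| <= C * w k.+1 j `^ theta.
  by apply: IH => //; lia.
have h3 : `|A i j - A i k - A k j| <= K * w i j `^ theta.
  by apply: dA => //; exact: ltnW.
have h4 : `|A k j - A k k.+1 - A k.+1 j| <= K * w i j `^ theta.
  apply: le_trans (dA k k.+1 j _ _ dj jn) _ => //; first exact: leq_trans mi ik.
  rewrite ler_wpM2l// ge0_ler_powR ?nnegrE ?w0 ?(leq_trans mi)// ?(ltnW dj)//.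
  by rewrite wS// ltnW.
rewrite (@big_cat_nat _ _ _ k)//= ?(ltnW dj)// (@big_cat_nat _ _ _ k.+1 k)//= big_nat1.
have -> : \sum_(i <= r < k) A r r.+1 +
   (A k k.+1 + \sum_(k.+1 <= r < j) A r r.+1) - A i j =
   (\sum_(i <= r < k) A r r.+1 - A i k) +
   ((\sum_(k.+1 <= r < j) A r r.+1 - A k.+1 j) +
   (- (A i j - A i k - A k j) - (A k j - A k k.+1 - A k.+1 j))).
  set x := \sum_(_ <= _ < k) _; set y := \sum_(_ <= _ < _) _.
  set z := A i j; set a := A i k; set b := A k j; set c := A k k.+1.
  set e := A k.+1 j.
  apply/eqP; rewrite -subr_eq0; apply/eqP.
  rewrite !(opprD, opprK, addrA).
  rewrite (ACl ((1*5)*(2*13)*(3*7)*(4*9)*(6*10)*(8*14)*(11*12)))/=.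
  by rewrite !subrr !addNr !addr0.
have h5 : C * w i k `^ theta <= C * (2 `^ (- theta) * w i j `^ theta).
  rewrite ler_wpM2l// half// ?w0//.
  by rewrite (leq_trans (ltnW dj)).
have h6 : C * w k.+1 j `^ theta <= C * (2 `^ (- theta) * w i j `^ theta).
  by rewrite ler_wpM2l// half// ?w0// (leq_trans mi)// leqW.
rewrite -[in leRHS]CE.
apply: le_trans (ler_normD _ _) _; apply: le_trans (lerD (lexx _) (ler_normD _ _)) _.
apply: le_trans (lerD (lexx _) (lerD (lexx _) (ler_normB _ _))) _.
rewrite normrN; move: h1 h2 h3 h4 h5 h6.
set X := w i j `^ theta; set Y := 2 `^ (- theta).
have -> : C * (Y * X) = C * Y * X by rewrite mulrA.
have -> : (C * (2 * Y) + 2 * K) * X = C * Y * X + C * Y * X + K * X + K * X by ring.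
lra.
Qed.

(** The defect of (g_l - g_k) f_k at an intermediate point is a product of an increment of g and an
    increment of f, hence of order alpha + beta > 1, and sewing applies. The scale [X] is kept apart
    from [w1] because the absorption argument for solutions needs linearity in it. The power of 2
    comes from the sum of two normalized controls being at most 2. *)
Lemma young_loeve_sum (R : realType) (U : normedModType R) (a b : R)
    (w1 w2 : R -> R -> R) (alpha beta X : R) (f : R -> U) (g : R -> R)
    (tau : nat -> R) (m n : nat) :
  0 < alpha -> 0 < beta -> 1 < alpha + beta -> 0 <= X ->
  control a b w1 -> control a b w2 ->
  (forall u v, a <= u -> u <= v -> v <= b -> `|f v - f u| <= X * w1 u v `^ alpha) ->
  (forall u v, a <= u -> u <= v -> v <= b -> `|g v - g u| <= w2 u v `^ beta) ->
  (m <= n)%N ->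
  (forall i j, (m <= i)%N -> (i <= j)%N -> (j <= n)%N ->
     [/\ a <= tau i, tau i <= tau j & tau j <= b]) ->
  `|\sum_(m <= k < n) (g (tau k.+1) - g (tau k)) *: f (tau k)
    - (g (tau n) - g (tau m)) *: f (tau m)|
  <= sewing_cst (alpha + beta) * 2 `^ (alpha + beta)
     * (X * w1 (tau m) (tau n) `^ alpha * w2 (tau m) (tau n) `^ beta).
Proof.
move=> al0 be0 th1 X0 [w10 w1D] [w20 w2D] fw gw mn tauP.
set W1 := w1 (tau m) (tau n); set W2 := w2 (tau m) (tau n).
have [am tmn nb] := tauP m n (leqnn _) mn (leqnn _).
have W10 : 0 <= W1 by apply: w10.
have W20 : 0 <= W2 by apply: w20.
(* Normalizing both controls to total mass 1 reduces the claim to the sewing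
   lemma for the single control [w]. *)
pose w (k l : nat) := w1 (tau k) (tau l) / W1 + w2 (tau k) (tau l) / W2.
have c1 k l : (m <= k)%N -> (k <= l)%N -> (l <= n)%N -> 0 <= w1 (tau k) (tau l).
  by move=> mk kl ln; have [? ? ?] := tauP k l mk kl ln; exact: w10.
have c2 k l : (m <= k)%N -> (k <= l)%N -> (l <= n)%N -> 0 <= w2 (tau k) (tau l).
  by move=> mk kl ln; have [? ? ?] := tauP k l mk kl ln; exact: w20.
have d1 k r l : (m <= k)%N -> (k <= r)%N -> (r <= l)%N -> (l <= n)%N ->
    w1 (tau k) (tau r) + w1 (tau r) (tau l) <= w1 (tau k) (tau l).
  move=> mk kr rl ln.
  have [? ? ?] := tauP k r mk kr (leq_trans rl ln).
  have [? ? ?] := tauP r l (leq_trans mk kr) rl ln.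
  exact: w1D.
have d2 k r l : (m <= k)%N -> (k <= r)%N -> (r <= l)%N -> (l <= n)%N ->
    w2 (tau k) (tau r) + w2 (tau r) (tau l) <= w2 (tau k) (tau l).
  move=> mk kr rl ln.
  have [? ? ?] := tauP k r mk kr (leq_trans rl ln).
  have [? ? ?] := tauP r l (leq_trans mk kr) rl ln.
  exact: w2D.
have m1 k l : (m <= k)%N -> (k <= l)%N -> (l <= n)%N -> w1 (tau k) (tau l) <= W1.
  move=> mk kl ln.
  have := d1 m k n (leqnn _) mk (leq_trans kl ln) (leqnn _).
  have := d1 k l n mk kl ln (leqnn _).
  have := c1 m k (leqnn _) mk (leq_trans kl ln).
  have := c1 l n (leq_trans mk kl) ln (leqnn _).
  by rewrite /W1; lra.
have m2 k l : (m <= k)%N -> (k <= l)%N -> (l <= n)%N -> w2 (tau k) (tau l) <= W2.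
  move=> mk kl ln.
  have := d2 m k n (leqnn _) mk (leq_trans kl ln) (leqnn _).
  have := d2 k l n mk kl ln (leqnn _).
  have := c2 m k (leqnn _) mk (leq_trans kl ln).
  have := c2 l n (leq_trans mk kl) ln (leqnn _).
  by rewrite /W2; lra.
have wge0 k l : (m <= k)%N -> (k <= l)%N -> (l <= n)%N -> 0 <= w k l.
  by move=> *; rewrite addr_ge0// divr_ge0// ?c1 ?c2.
(* If [W1] is 0, the quotient by [W1] is 0 by convention, but then [w1] vanishes on all subintervals
   by monotonicity. *)
have v1 k l : (m <= k)%N -> (k <= l)%N -> (l <= n)%N ->
    w1 (tau k) (tau l) <= W1 * w k l.
  move=> mk kl ln; have [W1E|W1n] := eqVneq W1 0.
    by rewrite W1E mul0r -W1E m1.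
  by rewrite /w mulrDr mulrCA divff// mulr1 lerDl mulr_ge0// divr_ge0// c2.
have v2 k l : (m <= k)%N -> (k <= l)%N -> (l <= n)%N ->
    w2 (tau k) (tau l) <= W2 * w k l.
  move=> mk kl ln; have [W2E|W2n] := eqVneq W2 0.
    by rewrite W2E mul0r -W2E m2.
  by rewrite /w addrC mulrDr mulrCA divff// mulr1 lerDl mulr_ge0// divr_ge0// c1.
have wmn : w m n <= 2.
  have h x : x / x <= 1 :> R.
    by have [->|x0] := eqVneq x 0; rewrite ?mul0r// divff.
  by rewrite /w; have := h W1; have := h W2; rewrite /W1 /W2; lra.
pose A k l := (g (tau l) - g (tau k)) *: f (tau k).
set K := X * W1 `^ alpha * W2 `^ beta.
have K0 : 0 <= K by rewrite !mulr_ge0// powR_ge0.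
have := @discrete_sewing R U m n A w K (alpha + beta) th1 K0 wge0.
move=> /(_ _ _ _ m n (leqnn _) mn (leqnn _)) H.
apply: (le_trans (H _ _ _)).
- move=> i k j mi ik kj jn; rewrite /w addrACA -!mulrDl.
  by rewrite lerD// ler_wpM2r ?invr_ge0// ?d1 ?d2.
- by move=> i; rewrite /A subrr scale0r.
- move=> i k j mi ik kj jn.
  have -> : A i j - A i k - A k j = - ((g (tau j) - g (tau k)) *: (f (tau k) - f (tau i))).
    rewrite /A scalerBr opprB -scalerBl opprB addrA addrNK.
    by congr (_ - _).
  have [? ? ?] := tauP i k mi ik (leq_trans kj jn).
  have [? ? ?] := tauP k j (leq_trans mi ik) kj jn.
  have ij := leq_trans ik kj.
  rewrite normrN normrZ mulrC.
  apply: (@le_trans _ _ (X * (W1 * w i j) `^ alpha * (W2 * w i j) `^ beta)).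
    rewrite ler_pM//.
      apply: le_trans (fw _ _ _ _ _) _ => //.
      rewrite ler_wpM2l// ge0_ler_powR ?nnegrE ?c1// ?mulr_ge0 ?wge0// ?(ltW al0)//.
        exact: leq_trans kj jn.
      apply: le_trans (v1 i j mi ij jn).
      have := d1 i k j mi ik kj jn; have := c1 k j (leq_trans mi ik) kj jn; lra.
    apply: le_trans (gw _ _ _ _ _) _ => //.
    rewrite ge0_ler_powR ?nnegrE ?c2// ?mulr_ge0 ?wge0// ?(ltW be0)//.
      exact: leq_trans mi ik.
    apply: le_trans (v2 i j mi ij jn).
    have := d2 i k j mi ik kj jn; have := c2 i k mi ik (leq_trans kj jn); lra.
  rewrite !powRM ?wge0// powRD; last by apply/implyP; lra.
  by rewrite /K !mulrA [X * _ * _ * _]mulrAC.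
rewrite -mulrA [K * _]mulrC mulrA ler_wpM2r//.
rewrite ler_wpM2l// ?ge0_ler_powR ?nnegrE ?wge0//; last by lra.
by rewrite divr_ge0// ltW// sewing_denominator_gt0.
Qed.

(** * Sums over partitions, and the variation of a path as a control *)

Definition psum (R : realType) (V : nmodType) (F : R -> R -> V) (d a : R)
    (s : seq R) : V :=
  \sum_(0 <= k < size s) F (nth d (a :: s) k) (nth d (a :: s) k.+1).

Lemma psum_cons (R : realType) (V : nmodType) (F : R -> R -> V) (d a x : R)
    (s : seq R) : psum F d a (x :: s) = F a x + psum F d x s.
Proof. by rewrite /psum big_nat_recl. Qed.

Lemma psum_nil (R : realType) (V : nmodType) (F : R -> R -> V) (d a : R) :
  psum F d a [::] = 0.
Proof. by rewrite /psum big_geq. Qed.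

(** The default of [nth] is never read. Being able to change it matters for concatenation: each
    interval uses its own right end as default. *)
Lemma psum_default (R : realType) (V : nmodType) (F : R -> R -> V) (d d' a : R)
    (s : seq R) : psum F d a s = psum F d' a s.
Proof.
by elim: s a => [|x s IH] a; rewrite ?psum_nil// !psum_cons IH.
Qed.

Lemma psum_cat (R : realType) (V : nmodType) (F : R -> R -> V) (d a : R)
    (s1 s2 : seq R) :
  psum F d a (s1 ++ s2) = psum F d a s1 + psum F d (last a s1) s2.
Proof.
elim: s1 a => [|x s1 IH] a; first by rewrite psum_nil add0r.
by rewrite cat_cons !psum_cons IH addrA.
Qed.

Lemma psum_ge0 (R : realType) (F : R -> R -> R) (d a : R) (s : seq R) :
  (forall u v, 0 <= F u v) -> 0 <= psum F d a s.
Proof. by move=> F0; apply: sumr_ge0. Qed.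

Lemma psum_le (R : realType) (F G : R -> R -> R) (a b : R) (s : seq R) :
  (forall u v, a <= u -> u < v -> v <= b -> F u v <= G u v) ->
  itv_partition a b s -> psum F b a s <= psum G b a s.
Proof.
elim: s a => [|x s IH] a FG ps; first by rewrite !psum_nil.
have xb := itv_partition_le (itv_partition_cons ps).
have /andP[ax _] : path <%O a (x :: s) by case: ps.
rewrite !psum_cons lerD//; first exact: FG.
apply: IH; last exact: itv_partition_cons ps.
by move=> u v xu; apply: FG; rewrite (le_trans (ltW ax)).
Qed.

Lemma psum_tele (R : realType) (V : zmodType) (g : R -> V) (a b : R) (s : seq R) :
  itv_partition a b s -> psum (fun u v => g v - g u) b a s = g b - g a.
Proof.
elim: s a => [|x s IH] a ps.
  by rewrite psum_nil (itv_partition_nil ps) subrr.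
rewrite psum_cons IH; last exact: itv_partition_cons ps.
by rewrite addrC subrKA.
Qed.

(** For F u v = |f v - f u|^p this is the p-th power of the p-variation of f on [s, t]. A real [sup]
    is used, so every property needs a bound on the partition sums. *)
Definition variation_sup (R : realType) (F : R -> R -> R) (s t : R) : R :=
  sup [set psum F t s l | l in itv_partition s t].

Definition bounded_variation_on (R : realType) (F : R -> R -> R) (a b M : R) :=
  forall l, itv_partition a b l -> psum F b a l <= M.

Lemma trivial_partition (R : realType) (a b : R) :
  a <= b -> exists l, itv_partition a b l.
Proof.
rewrite le_eqVlt => /predU1P[->|ab]; first by exists [::]; split => /=.
by exists [:: b]; exact: itv_partition1.
Qed.

Section variation_control.
Context (R : realType) (F : R -> R -> R) (a b M : R).
Hypothesis F0 : forall u v, 0 <= F u v.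
Hypothesis FM : bounded_variation_on F a b M.

Lemma sub_variation (s t : R) : a <= s -> s <= t -> t <= b ->
  bounded_variation_on F s t M.
Proof.
move=> as_ st tb l pl.
have [l1 p1] := trivial_partition as_; have [l2 p2] := trivial_partition tb.
have := FM (itv_partition_cat p1 (itv_partition_cat pl p2)).
have [_ /eqP e1] := p1; have [_ /eqP e2] := pl.
rewrite !psum_cat e1 e2 (psum_default _ t b); apply: le_trans.
by rewrite addrCA lerDl addr_ge0// psum_ge0.
Qed.

Lemma variation_has_sup (s t : R) : a <= s -> s <= t -> t <= b ->
  has_sup [set psum F t s l | l in itv_partition s t].
Proof.
move=> as_ st tb; split.
  by have [l pl] := trivial_partition st; exists (psum F t s l); exists l.
by exists M => _ [l pl <-]; exact: sub_variation pl.
Qed.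

Lemma psum_le_variation (s t : R) l : a <= s -> s <= t -> t <= b ->
  itv_partition s t l -> psum F t s l <= variation_sup F s t.
Proof.
by move=> as_ st tb pl; apply: sup_upper_bound; [exact: variation_has_sup|exists l].
Qed.

Lemma variation_le (s t : R) : a <= s -> s <= t -> t <= b ->
  variation_sup F s t <= M.
Proof.
move=> as_ st tb; apply: sup_le_ub; first by case: (variation_has_sup as_ st tb).
by move=> _ [l pl <-]; exact: sub_variation pl.
Qed.

(** A partition of [s, u] followed by one of [u, t] is a partition of [s, t]; superadditivity
    follows since a sum of two suprema is the supremum of the sums. *)
Lemma variation_control : control a b (variation_sup F).
Proof.
split=> [s t as_ st tb|s u t as_ su ut tb].
  have [l pl] := trivial_partition st.
  exact: le_trans (psum_ge0 _ _ _ F0) (psum_le_variation as_ st tb pl).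
have ub := le_trans ut tb; have au := le_trans as_ su.
rewrite -sup_sumE; [|exact: variation_has_sup|exact: variation_has_sup].
apply: sup_le_ub.
  have [l1 p1] := trivial_partition su; have [l2 p2] := trivial_partition ut.
  by exists (psum F u s l1 + psum F t u l2); exists (psum F u s l1);
    [exists l1|exists (psum F t u l2) => //; exists l2].
move=> _ [_ [l1 p1 <-]] [_ [l2 p2 <-] <-].
have := psum_le_variation as_ (le_trans su ut) tb (itv_partition_cat p1 p2).
by have [_ /eqP e1] := p1; rewrite psum_cat e1 (psum_default _ u t).
Qed.

Lemma le_variation (s t : R) : F s s = 0 -> a <= s -> s <= t -> t <= b ->
  F s t <= variation_sup F s t.
Proof.
move=> Fss as_ st tb.
have [stE|nst] := eqVneq s t.
  subst t; rewrite Fss; apply: le_trans (psum_le_variation as_ st tb _).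
    exact: (psum_ge0 _ _ [::] F0).
  by split => /=.
have lt_st : s < t by rewrite lt_neqAle nst.
have := psum_le_variation as_ st tb (itv_partition1 lt_st).
by rewrite psum_cons psum_nil addr0.
Qed.

End variation_control.

(** Steps of length delta / 2 keep the mesh strictly below delta. Such partitions are needed to
    evaluate Young integrals, which are characterized only along fine partitions. *)
Lemma fine_partition (R : realType) (a b delta : R) : a <= b -> 0 < delta ->
  exists2 s, itv_partition a b s & path (fun u v => v - u < delta) a s.
Proof.
move=> ab d0.
suff main n : forall x, x <= b -> b - x < n%:R * (delta / 2) ->
    exists2 s, itv_partition x b s & path (fun u v => v - u < delta) x s.
  apply: (main (Num.bound ((b - a) / (delta / 2))) a ab).
  rewrite -ltr_pdivrMr ?divr_gt0//.
  by apply: archi_boundP; rewrite divr_ge0 ?subr_ge0// divr_ge0// ltW.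
elim: n => [|n IH] x xb; first by rewrite mul0r; lra.
move=> xn; have [bd|bd] := ltP (b - x) delta.
  move: xb; rewrite le_eqVlt => /predU1P[->|xb]; first by exists [::].
  by exists [:: b]; [exact: itv_partition1|rewrite /= bd].
have [||s ps ms] := IH (x + delta / 2); first by lra.
  by move: xn; rewrite -natr1 mulrDl mul1r; lra.
exists (x + delta / 2 :: s) => /=.
  by case: ps => p1 p2; split => //=; rewrite p1 andbT ltrDl divr_gt0.
by rewrite ms andbT; lra.
Qed.

(** * Young differential equations *)

Lemma young_loeve_partition (R : realType) (U : normedModType R) (a b : R)
    (w1 w2 : R -> R -> R) (alpha beta X : R) (f : R -> U) (g : R -> R)
    (s t : R) (l : seq R) :
  0 < alpha -> 0 < beta -> 1 < alpha + beta -> 0 <= X ->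
  control a b w1 -> control a b w2 ->
  (forall u v, a <= u -> u <= v -> v <= b ->
     `|f v - f u| <= X * w1 u v `^ alpha) ->
  (forall u v, a <= u -> u <= v -> v <= b -> `|g v - g u| <= w2 u v `^ beta) ->
  a <= s -> t <= b -> itv_partition s t l ->
  `|psum (fun u v => (g v - g u) *: f u) t s l - (g t - g s) *: f s|
  <= sewing_cst (alpha + beta) * 2 `^ (alpha + beta)
     * (X * w1 s t `^ alpha * w2 s t `^ beta).
Proof.
move=> al0 be0 th1 X0 cw1 cw2 fw gw as_ tb pl.
have := @young_loeve_sum R U a b w1 w2 alpha beta X f g (nth t (s :: l)) 0 (size l)
  al0 be0 th1 X0 cw1 cw2 fw gw (leq0n _).
rewrite (itv_partition_nth_size t pl)/=; apply => i j _ ij jl; split.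
- apply: le_trans as_ _; apply: itv_partition_nth_ge pl.
  by rewrite ltnS (leq_trans ij).
- have sl : sorted <%R (s :: l) by case: pl.
  by rewrite lt_sorted_leq_nth// inE /= ltnS// (leq_trans ij).
- by apply: le_trans (itv_partition_nth_le _ pl) tb; rewrite ltnS.
Qed.

(** Both integrals start at a, so a fine partition of [a, s] is used alone for [I1] and continued by
    one of [s, t] for [I2]; the common part cancels. Tagging by left ends turns the Riemann sums
    into [psum]. *)
Lemma young_integral_increment (R : realType) (U : normedModType R) (f : R -> U)
    (g : R -> R) (a s t : R) (I1 I2 : U) (C : R) :
  a <= s -> s <= t ->
  is_young_integral f g a s I1 -> is_young_integral f g a t I2 ->
  (forall l, itv_partition s t l ->
    `|psum (fun u v => (g v - g u) *: f u) t s l - (g t - g s) *: f s| <= C) ->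
  `|I2 - I1 - (g t - g s) *: f s| <= C.
Proof.
move=> as_ st [_ _ _ H1] [_ _ _ H2] HB.
apply/ler_addgt0Pr => e e0.
have e2 : 0 < e / 2 by rewrite divr_gt0.
have [d1 d10 {}H1] := H1 _ e2; have [d2 d20 {}H2] := H2 _ e2.
have dm : 0 < Num.min d1 d2 by rewrite lt_min d10.
have [l1 p1 m1] := fine_partition as_ dm.
have [l2 p2 m2] := fine_partition st dm.
have [s1 /eqP e1] := p1; have [s2 _] := p2.
pose F u v := (g v - g u) *: f u.
have mesh d x y l : path <%R x l -> path (fun u v => v - u < Num.min d1 d2) x l ->
    Num.min d1 d2 <= d -> forall k, (k < size l)%N ->
    nth y (x :: l) k.+1 - nth y (x :: l) k < d /\
    nth y (x :: l) k <= nth y (x :: l) k <= nth y (x :: l) k.+1.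
  move=> /(pathP y) pl /(pathP y) ml dd k kl; split.
    exact: lt_le_trans (ml k kl) dd.
  by rewrite lexx/= ltW// (pl k kl).
have {}H1 : `|psum F s a l1 - I1| < e / 2.
  apply: (H1 l1 (nth s (a :: l1)) p1); apply: mesh => //.
  by rewrite ge_min lexx.
have {}H2 : `|psum F t a (l1 ++ l2) - I2| < e / 2.
  apply: (H2 (l1 ++ l2) (nth t (a :: l1 ++ l2))).
    exact: itv_partition_cat p1 p2.
  apply: mesh; [by rewrite cat_path s1 e1|by rewrite cat_path m1 e1|].
  by rewrite ge_min lexx orbT.
have {}HB := HB _ p2.
rewrite psum_cat e1 (psum_default _ t s) in H2.
have -> : I2 - I1 - (g t - g s) *: f s =
   (psum F t s l2 - (g t - g s) *: f s)
   + ((psum F s a l1 - I1) - (psum F s a l1 + psum F t s l2 - I2)).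
  set x := psum F t s l2; set y := psum F s a l1; set z := _ *: _.
  rewrite !(opprD, opprK, addrA).
  by rewrite (ACl (7*4*2*(1*6)*(3*5)))/= !subrr !addr0.
apply: le_trans (ler_normD _ _) _.
have := ler_normB (psum F s a l1 - I1) (psum F s a l1 + psum F t s l2 - I2).
rewrite /F in HB *; lra.
Qed.

Lemma le_add_half_pow (R : realType) (x y c : R) :
  (forall n, x <= y + c / 2 ^+ n) -> x <= y.
Proof.
move=> H; apply/ler_addgt0Pr => e e0.
have n_gt := archi_boundP (normr_ge0 (c / e)).
set n := Num.bound _ in n_gt; apply: le_trans (H n) _.
rewrite lerD2l ler_pdivrMr ?exprn_gt0// -ler_pdivrMl// mulrC.
apply: le_trans (ler_norm _) _; apply: le_trans (ltW n_gt) _.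
by rewrite -natrX ler_nat ltnW// ltn_expl.
Qed.

Lemma control_le (R : realType) (a b : R) (w : R -> R -> R) (s t : R) :
  control a b w -> a <= s -> s <= t -> t <= b -> w s t <= w a b.
Proof.
move=> [w0 wD] as_ st tb.
have h1 := wD a s b (lexx _) as_ (le_trans st tb) (lexx _).
have h2 := wD s t b as_ st tb (lexx _).
have h3 := w0 a s (lexx _) as_ (le_trans st tb).
have h4 := w0 t b (le_trans as_ st) tb (lexx _).
lra.
Qed.

Section young_solution.
Context (R : realType) (N d : nat) (V : 'I_d -> 'cV[R]_N -> 'cV[R]_N).
Context (h : 'I_d -> R -> R) (x : 'cV[R]_N) (phi : R -> 'cV[R]_N).
Context (M L q S : R).
Hypothesis M0 : 0 <= M.
Hypothesis L0 : 0 <= L.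
Hypothesis VM : forall i z, `|V i z| <= M.
Hypothesis VL : forall i z1 z2, `|V i z1 - V i z2| <= L * `|z1 - z2|.
Hypothesis q12 : 1 <= q < 2.
Hypothesis hS : forall i,
  bounded_variation_on (fun u v => `|h i v - h i u| `^ q) 0 1 S.
Hypothesis sol : is_young_solution V h x phi.

(** A single control for all components of the driver, of total mass at most d S. *)
Let w (s t : R) :=
  \sum_(i < d) variation_sup (fun u v => `|h i v - h i u| `^ q) s t.

Let q0 : 0 < q. Proof. by case/andP: q12; lra. Qed.

Let qV : 2^-1 < q^-1.
Proof. by rewrite ltf_pV2 ?posrE//; case/andP: q12. Qed.

Let F0 i u v : 0 <= `|h i v - h i u| `^ q. Proof. exact: powR_ge0. Qed.

Let wc : control 0 1 w.
Proof.
split=> [s t *|s u t *].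
  apply: sumr_ge0 => i _.
  by have [+ _] := variation_control (F0 i) (hS i); apply.
rewrite -big_split/=; apply: ler_sum => i _.
by have [_ +] := variation_control (F0 i) (hS i); apply.
Qed.

Let wS : w 0 1 <= d%:R * S.
Proof.
rewrite -[d in leRHS]card_ord mulr_natl -sumr_const; apply: ler_sum => i _.
exact: (variation_le (F0 i) (hS i)).
Qed.

Let hw i u v : 0 <= u -> u <= v -> v <= 1 -> `|h i v - h i u| <= w u v `^ q^-1.
Proof.
move=> u0 uv v1.
have -> : `|h i v - h i u| = (`|h i v - h i u| `^ q) `^ q^-1.
  by rewrite -powRrM divff ?gt_eqF// powRr1.
rewrite ge0_ler_powR ?nnegrE ?invr_ge0 ?(ltW q0)//.
  by have [+ _] := wc; apply.
apply: (@le_trans _ _ (variation_sup (fun u v => `|h i v - h i u| `^ q) u v)).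
  apply: (le_variation (F0 i) (hS i)) => //.
  by rewrite subrr normr0 powR0 ?gt_eqF.
rewrite /w (bigD1 i)//= lerDl; apply: sumr_ge0 => j _.
by have [+ _] := variation_control (F0 j) (hS j); apply.
Qed.

Let theta_cst (alpha : R) :=
  sewing_cst (alpha + q^-1) * 2 `^ (alpha + q^-1).

(** Any regularity of phi is upgraded to regularity of order 1/q against [w]: the leading terms cost
    [M], and the Young remainders cost [L * X] because V_i(phi) inherits the increments of phi. It
    serves first with the p-variation of phi, then with [w] itself. *)
Let solution_step (w1 : R -> R -> R) (alpha X : R) :
  0 < alpha -> 1 < alpha + q^-1 -> 0 <= X -> control 0 1 w1 ->
  (forall u v, 0 <= u -> u <= v -> v <= 1 ->
     `|phi v - phi u| <= X * w1 u v `^ alpha) ->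
  forall s t, 0 <= s -> s <= t -> t <= 1 ->
    `|phi t - phi s| <=
      d%:R * (M + theta_cst alpha * (L * X * w1 s t `^ alpha)) * w s t `^ q^-1.
Proof.
move=> al0 th1 X0 w1c phiw s t s0 st t1.
have [_ _ _ phiI] := sol.
have [Is [Is_int ->]] : exists I : 'I_d -> 'cV[R]_N,
    (forall i, is_young_integral (fun s => V i (phi s)) (h i) 0 s (I i))
    /\ phi s = x + \sum_(i < d) I i.
  by apply: phiI; rewrite in_itv/= s0 (le_trans st).
have [It [It_int ->]] : exists I : 'I_d -> 'cV[R]_N,
    (forall i, is_young_integral (fun s => V i (phi s)) (h i) 0 t (I i))
    /\ phi t = x + \sum_(i < d) I i.
  by apply: phiI; rewrite in_itv/= t1 (le_trans s0).
rewrite opprD addrACA subrr add0r -sumrB.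
rewrite -[d in leRHS]card_ord -mulrA mulr_natl -sumr_const.
apply: le_trans (ler_norm_sum _ _ _) _; apply: ler_sum => i _.
have -> : It i - Is i = (h i t - h i s) *: V i (phi s) +
    (It i - Is i - (h i t - h i s) *: V i (phi s)) by rewrite [RHS]addrC addrNK.
rewrite mulrDl; apply: le_trans (ler_normD _ _) (lerD _ _).
  by rewrite normrZ mulrC ler_pM// hw.
apply: (young_integral_increment s0 st (Is_int i) (It_int i)) => l pl.
rewrite -!mulrA mulrA.
apply: le_trans (@young_loeve_partition _ _ 0 1 w1 w _ _ _ (fun u => V i (phi u)) (h i)
   s t l al0 _ th1 (mulr_ge0 L0 X0) w1c wc _ (hw i) s0 t1 pl) _.
- by rewrite invr_gt0.
- move=> u v u0 uv v1; apply: le_trans (VL _ _ _) _.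
  by rewrite -mulrA ler_wpM2l// phiw.
- by rewrite /theta_cst !mulrA.
Qed.

(** The hypothesis makes the remainder at most half of the constant it starts from, so that the a
    priori bound closes on the whole of [0, 1] without subdividing it. *)
Lemma young_solution_bound :
  d%:R * (sewing_cst (2 / q) * 2 `^ (2 / q) * L) * (d%:R * S) `^ q^-1 <= 2^-1 ->
  `|phi 1 - x| <= 2 * d%:R * M * (d%:R * S) `^ q^-1.
Proof.
move=> small.
have [phi0 _ [p [p12 [Mp phip]]] _] := sol.
have p0 : 0 < p by case/andP: p12; lra.
have pV : 2^-1 < p^-1 by rewrite ltf_pV2 ?posrE//; case/andP: p12.
pose Fp u v := `|phi v - phi u| `^ p.
have Fp0 u v : 0 <= Fp u v by exact: powR_ge0.
have Fpb : bounded_variation_on Fp 0 1 Mp by exact: phip.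
have wpc := variation_control Fp0 Fpb.
have W0 : 0 <= w 0 1 by case: wc => + _; apply.
have qV0 : 0 <= q^-1 by rewrite invr_ge0 ltW.
have wle s t : 0 <= s -> s <= t -> t <= 1 -> w s t `^ q^-1 <= w 0 1 `^ q^-1.
  move=> s0 st t1; rewrite ge0_ler_powR ?nnegrE//; last exact: control_le wc _ _ _.
  by case: wc => + _; apply.
have cst0 th : 1 < th -> 0 <= sewing_cst th * 2 `^ th.
  by move=> th1; rewrite mulr_ge0 ?powR_ge0// divr_ge0// ltW// sewing_denominator_gt0.
(* The finite p-variation of [phi] only yields some constant [X0] with
   [|phi_t - phi_s| <= X0 w(s, t)^(1/q)]; a further use of Young's estimate
   replaces a constant [X] by [d M + X / 2], hence eventually by [2 d M]. *)
have [X0 X00 HX0] : exists2 X0, 0 <= X0 & forall s t, 0 <= s -> s <= t -> t <= 1 ->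
    `|phi t - phi s| <= X0 * w s t `^ q^-1.
  have th1 : 1 < p^-1 + q^-1 by have := qV; lra.
  pose Y := variation_sup Fp 0 1 `^ p^-1.
  exists (d%:R * (M + theta_cst p^-1 * (L * 1 * Y))).
    by rewrite mulr_ge0// addr_ge0// mulr_ge0 ?cst0// !mulr_ge0// powR_ge0.
  move=> s t s0 st t1; apply: le_trans
    (@solution_step (variation_sup Fp) p^-1 1 _ th1 ler01 wpc _ s t s0 st t1) _.
  - by rewrite invr_gt0.
  - move=> u v u0 uv v1; rewrite mul1r.
    have -> : `|phi v - phi u| = Fp u v `^ p^-1.
      by rewrite -powRrM divff ?gt_eqF// powRr1.
    rewrite ge0_ler_powR ?nnegrE ?invr_ge0 ?(ltW p0)//; first by case: wpc => + _; apply.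
    by apply: (le_variation Fp0 Fpb) => //; rewrite /Fp subrr normr0 powR0 ?gt_eqF.
  - have hY : variation_sup Fp s t `^ p^-1 <= Y.
      have pV0 : 0 <= p^-1 by rewrite invr_ge0 ltW.
      have [wp0 _] := wpc.
      have v0 := wp0 s t s0 st t1; have v1 := wp0 0 1 (lexx _) ler01 (lexx _).
      exact: (ge0_ler_powR pV0 v0 v1 (control_le wpc s0 st t1)).
    have c0 : 0 <= theta_cst p^-1 by exact: cst0.
    apply: (ler_wpM2r (powR_ge0 _ _)); apply: (ler_wpM2l (ler0n _ _)).
    rewrite lerD2l; apply: (ler_wpM2l c0).
    exact: (ler_wpM2l (mulr_ge0 L0 ler01) hY).
have th1 : 1 < q^-1 + q^-1 by have := qV; lra.
have th2 : q^-1 + q^-1 = 2 / q by rewrite mulr_natl mulr2n.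
have W1 : w 0 1 `^ q^-1 <= (d%:R * S) `^ q^-1.
  by rewrite ge0_ler_powR ?nnegrE// (le_trans W0 wS).
have key n : forall s t, 0 <= s -> s <= t -> t <= 1 ->
    `|phi t - phi s| <= (2 * d%:R * M + X0 / 2 ^+ n) * w s t `^ q^-1.
  elim: n => [|n IH] s t s0 st t1.
    apply: le_trans (HX0 s t s0 st t1) _; rewrite ler_wpM2r ?powR_ge0// expr0 divr1.
    by rewrite lerDr !mulr_ge0.
  set X := _ + _ in IH.
  have X_ge0 : 0 <= X by rewrite addr_ge0 ?mulr_ge0// invr_ge0 exprn_ge0.
  apply: le_trans (solution_step _ th1 X_ge0 wc IH s0 st t1) _.
    by rewrite invr_gt0.
  rewrite ler_wpM2r ?powR_ge0//.
  have -> : 2 * d%:R * M + X0 / 2 ^+ n.+1 = d%:R * M + X * 2^-1.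
    by rewrite /X exprS; field; rewrite expf_neq0.
  rewrite mulrDr lerD2l.
  apply: (@le_trans _ _ (X * (d%:R * (theta_cst q^-1 * L) * (d%:R * S) `^ q^-1))).
    have -> : d%:R * (theta_cst q^-1 * (L * X * w s t `^ q^-1)) =
      X * (d%:R * (theta_cst q^-1 * L)) * w s t `^ q^-1 by ring.
    have c0 : 0 <= theta_cst q^-1 by exact: cst0.
    rewrite [leRHS]mulrA.
    apply: (ler_wpM2l (mulr_ge0 X_ge0 (mulr_ge0 (ler0n _ _) (mulr_ge0 c0 L0)))).
    exact: le_trans (wle _ _ s0 st t1) W1.
  by apply: (ler_wpM2l X_ge0); rewrite /theta_cst th2; exact: small.
apply: (@le_trans _ _ (2 * d%:R * M * w 0 1 `^ q^-1)); last first.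
  by rewrite ler_wpM2l// !mulr_ge0.
apply: (@le_add_half_pow _ _ _ (X0 * w 0 1 `^ q^-1)) => n.
rewrite -phi0; apply: le_trans (key n 0 1 _ _ _) _ => //.
by rewrite mulrDl lerD2l mulrAC.
Qed.

End young_solution.

(** * Square integrable random variables *)

Section L2.
Context (disp : measure_display) (T : measurableType disp) (R : realType).
Context (P : probability T R).
Implicit Types X Y Z : T -> R.

Definition L2 X : Prop := X \in Lfun P 2%:E.

Definition ip X Y : R := fine 'E_P[X \* Y]%E.

Lemma L2P (X : {mfun T >-> R}) : L2 X <-> ('E_P[X \* X] < +oo)%E.
Proof.
have E : 'E_P[X \* X]%E = ('N[P]_2%:E[EFin \o X] `^ 2)%E.
  rewrite powR_Lnorm// unlock; apply: eq_integral => w _ /=.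
  by rewrite powR_mulrn// real_normK ?num_real// expr2.
split.
- rewrite /L2 inE => /andP[_]; rewrite inE /finite_norm E => h.
  exact: poweR_lty.
- rewrite /L2 inE => h; apply/andP; split; rewrite inE//= /finite_norm.
  move: h; rewrite E; apply: contraTT; rewrite -!leNgt !leye_eq => /eqP ->.
  by rewrite poweRyr ?pnatr_eq0.
Qed.

Lemma L2_0 : L2 0.
Proof. by have [] := Lfun_submod_closed P (lee1n 2). Qed.

Lemma L2_lin c X Y : L2 X -> L2 Y -> L2 (c *: X + Y).
Proof. by move=> hX hY; have [_ ] := Lfun_submod_closed P (lee1n 2); apply. Qed.

Lemma L2D X Y : L2 X -> L2 Y -> L2 (X + Y).
Proof. by move=> hX hY; rewrite -[X]scale1r; exact: L2_lin. Qed.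

Lemma L2Z c X : L2 X -> L2 (c *: X).
Proof. by move=> hX; rewrite -[_ *: X]addr0; apply: L2_lin => //; exact: L2_0. Qed.

Lemma L2B X Y : L2 X -> L2 Y -> L2 (X - Y).
Proof. by move=> hX hY; rewrite -scaleN1r; apply/L2D/L2Z. Qed.

Lemma L2_sum (I : Type) (r : seq I) (F : I -> T -> R) :
  (forall i, L2 (F i)) -> L2 (\sum_(i <- r) F i).
Proof.
move=> hF; elim: r => [|i r IH]; first by rewrite big_nil; exact: L2_0.
by rewrite big_cons; apply: L2D.
Qed.

Lemma ipC X Y : ip X Y = ip Y X.
Proof. by congr (fine 'E_P[_]); apply/funext => w; rewrite /= mulrC. Qed.

Lemma ip_fin X Y : L2 X -> L2 Y -> 'E_P[X \* Y]%E = (ip X Y)%:E.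
Proof.
by move=> hX hY; rewrite /ip fineK// expectation_fin_num// Lfun2_mul_Lfun1.
Qed.

Lemma ipDl X Y Z : L2 X -> L2 Y -> L2 Z -> ip (X + Y) Z = ip X Z + ip Y Z.
Proof.
move=> hX hY hZ; apply: EFin_inj; rewrite EFinD -!ip_fin//; last exact: L2D.
rewrite -expectationD ?Lfun2_mul_Lfun1//; congr ('E_P[_])%E.
by apply/funext => w /=; rewrite mulrDl.
Qed.

Lemma ipZl c X Z : L2 X -> L2 Z -> ip (c *: X) Z = c * ip X Z.
Proof.
move=> hX hZ; apply: EFin_inj; rewrite EFinM -!ip_fin//; last exact: L2Z.
rewrite -expectationZl ?Lfun2_mul_Lfun1//; congr ('E_P[_])%E.
by apply/funext => w; rewrite [RHS]mulrC mulrA.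
Qed.

Lemma ipBl X Y Z : L2 X -> L2 Y -> L2 Z -> ip (X - Y) Z = ip X Z - ip Y Z.
Proof.
by move=> *; rewrite -scaleN1r ipDl ?ipZl ?mulN1r//; exact: L2Z.
Qed.

Lemma ip_suml (I : Type) (r : seq I) (F : I -> T -> R) Z :
  (forall i, L2 (F i)) -> L2 Z -> ip (\sum_(i <- r) F i) Z = \sum_(i <- r) ip (F i) Z.
Proof.
move=> hF hZ; elim: r => [|i r IH].
  by rewrite !big_nil -(scale0r (0 : T -> R)) ipZl ?mul0r//; exact: L2_0.
by rewrite !big_cons ipDl ?IH//; exact: L2_sum.
Qed.

Lemma ip_ge0 X : 0 <= ip X X.
Proof. by rewrite fine_ge0// expectation_ge0// => w; exact: sqr_ge0. Qed.

Lemma ip_quadratic X Y (c : R) : L2 X -> L2 Y ->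
  0 <= ip X X - 2 * c * ip X Y + c ^+ 2 * ip Y Y.
Proof.
move=> hX hY; have hcY : L2 (c *: Y) by exact: L2Z.
have hD : L2 (X - c *: Y) by exact: L2B.
have := ip_ge0 (X - c *: Y).
rewrite (ipBl hX hcY hD) (ipZl _ hY hD) !(ipC _ (_ - _)).
rewrite (ipBl hX hcY hX) (ipBl hX hcY hY) !ipZl// (ipC Y X).
lra.
Qed.

Lemma ip_CS X Y : L2 X -> L2 Y -> ip X Y ^+ 2 <= ip X X * ip Y Y.
Proof.
move=> hX hY; have := ip_ge0 Y; rewrite le_eqVlt => /predU1P[Y0|Y0].
  have [->|n0] := eqVneq (ip X Y) 0; first by rewrite expr0n/= mulr_ge0// ip_ge0.
  (* With a degenerate Y the quadratic is affine in c; this c makes it equal to -1, a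
     contradiction. *)
  have := ip_quadratic ((ip X X + 1) / (2 * ip X Y)) hX hY.
  rewrite -Y0 mulr0 addr0.
  have -> : 2 * ((ip X X + 1) / (2 * ip X Y)) * ip X Y = ip X X + 1 by field.
  lra.
have := ip_quadratic (ip X Y / ip Y Y) hX hY.
have -> : ip X X - 2 * (ip X Y / ip Y Y) * ip X Y + (ip X Y / ip Y Y) ^+ 2 * ip Y Y
  = (ip X X * ip Y Y - ip X Y ^+ 2) / ip Y Y by field; rewrite gt_eqF.
by rewrite pmulr_lge0 ?invr_gt0// subr_ge0.
Qed.

Lemma ip_CS_le X Y a b : L2 X -> L2 Y -> 0 <= a -> 0 <= b ->
  ip X X <= a ^+ 2 -> ip Y Y <= b ^+ 2 -> `|ip X Y| <= a * b.
Proof.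
move=> hX hY a0 b0 hXa hYb.
rewrite -(@ler_pXn2r _ 2)// ?nnegrE ?mulr_ge0// real_normK ?num_real// exprMn.
by apply: le_trans (ip_CS hX hY) _; rewrite ler_pM ?ip_ge0.
Qed.

Lemma L2_dist X Y (e : R) : L2 X -> L2 Y -> 0 <= e ->
  ('N[P]_(2%:E)[EFin \o (X \- Y)%R] < e%:E)%E -> ip (X - Y) (X - Y) <= e ^+ 2.
Proof.
move=> hX hY e0 h; rewrite -lee_fin -ip_fin; [|exact: L2B..].
have -> : 'E_P[((X - Y) \* (X - Y))%R]%E = ('N[P]_2%:E[EFin \o (X \- Y)%R] `^ 2)%E.
  rewrite powR_Lnorm// unlock; apply: eq_integral => w _ /=.
  by rewrite powR_mulrn// real_normK ?num_real// expr2.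
rewrite -powR_mulrn// -poweR_EFin; apply: gt0_ler_poweR => //.
- by rewrite in_itv/= leey andbT Lnorm_ge0.
- by rewrite in_itv/= leey andbT lee_fin.
- exact: ltW.
Qed.

End L2.

(** * Variation of Cameron-Martin paths *)

(** Convexity of the power 1/r, applied at x^r and y^r, after which the increasing power r is taken
    on both sides. *)
Lemma powR_concave (R : realType) (r lam x y : R) :
  0 < r -> r <= 1 -> 0 <= lam -> lam <= 1 -> 0 <= x -> 0 <= y ->
  lam * x `^ r + (1 - lam) * y `^ r <= (lam * x + (1 - lam) * y) `^ r.
Proof.
move=> r0 r1 l0 l1 x0 y0.
have rV : 1 <= r^-1 by rewrite invf_ge1.
have c0 : 0 <= lam * x `^ r + (1 - lam) * y `^ r.
  by rewrite addr_ge0// mulr_ge0 ?powR_ge0// subr_ge0.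
have := convex_powR rV (Itv01 l0 l1) (x := x `^ r) (y := y `^ r).
rewrite !inE/= !in_itv/= !powR_ge0 => /(_ isT isT).
rewrite !convRE/= /unstable.onem -!powRrM mulfV ?gt_eqF// !powRr1//.
move=> H; apply: le_trans (ge0_ler_powR (ltW r0) _ _ H).
- by rewrite -powRrM mulVf ?gt_eqF// powRr1.
- by rewrite nnegrE powR_ge0.
- by rewrite nnegrE addr_ge0// mulr_ge0// subr_ge0.
Qed.

(** Both x + a and x + b are convex combinations of x and x + a + b, with complementary weights;
    adding the two concavity inequalities gives the claim. This is what makes disjoint increments
    negatively correlated for H <= 1/2. *)
Lemma powR_cross_le (R : realType) (r x a b : R) :
  0 < r -> r <= 1 -> 0 <= x -> 0 <= a -> 0 <= b ->
  x `^ r + (x + a + b) `^ r <= (x + a) `^ r + (x + b) `^ r.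
Proof.
move=> r0 r1 x0 a0 b0.
have := addr_ge0 a0 b0; rewrite le_eqVlt => /predU1P[ab0|ab0].
  have -> : a = 0 by lra.
  have -> : b = 0 by lra.
  by rewrite !addr0.
have h u v : 0 <= u -> 0 <= v -> u + v = a + b -> u / (a + b) <= 1.
  by move=> u0 v0 uv; rewrite ler_pdivrMr// mul1r; lra.
have y0 : 0 <= x + a + b by rewrite !addr_ge0.
have la0 : 0 <= a / (a + b) by rewrite divr_ge0// ltW.
have lb0 : 0 <= b / (a + b) by rewrite divr_ge0// ltW.
have la1 := h a b a0 b0 erefl; have lb1 := h b a b0 a0 (addrC _ _).
have h1 := powR_concave r0 r1 lb0 lb1 x0 y0.
have h2 := powR_concave r0 r1 la0 la1 x0 y0.
have e1 : b / (a + b) * x + (1 - b / (a + b)) * (x + a + b) = x + a.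
  by field; rewrite gt_eqF.
have e2 : a / (a + b) * x + (1 - a / (a + b)) * (x + a + b) = x + b.
  by field; rewrite gt_eqF.
rewrite e1 in h1; rewrite e2 in h2; apply: le_trans (lerD h1 h2).
set X := x `^ r; set Y := (x + a + b) `^ r.
rewrite le_eqVlt; apply/orP; left; apply/eqP; field; by rewrite gt_eqF.
Qed.

Lemma mfun_sumE (disp : measure_display) (T : measurableType disp) (R : realType)
    (n : nat) (c : 'I_n -> R) (F : 'I_n -> {mfun T >-> R}) :
  ((\sum_(k < n) c k *: F k : {mfun T >-> R}) : T -> R)
  = \sum_(k < n) c k *: (F k : T -> R).
Proof.
elim: n c F => [|n IH] c F; first by rewrite !big_ord0.
by rewrite !big_ord_recr/= -IH.
Qed.

Section cameron_martin.
Context (disp : measure_display) (T : measurableType disp) (R : realType).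
Context (P : probability T R) (H : R) (b : R -> {mfun T >-> R}).
Hypothesis H01 : 0 < H < 1.
Hypothesis b_cov : forall s t : R, s \in `[0, 1] -> t \in `[0, 1] ->
  'E_P[b s \* b t]%E =
  (2^-1 * (s `^ (2 * H) + t `^ (2 * H) - `|s - t| `^ (2 * H)))%:E.

Local Notation r := (2 * H).

Lemma fbm_L2 (t : R) : t \in `[0, 1] -> L2 P (b t).
Proof. by move=> t01; apply/L2P; rewrite b_cov// ltry. Qed.

Lemma fbm_ip (s t : R) : s \in `[0, 1] -> t \in `[0, 1] ->
  ip P (b s) (b t) = 2^-1 * (s `^ r + t `^ r - `|s - t| `^ r).
Proof. by move=> s01 t01; rewrite /ip b_cov. Qed.

(** [Z] is the orthogonal projection of [W] on the closed span: Z - W is orthogonal to every b_t,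
    hence to the finite combinations approximating [Z], hence to [Z]. This controls a norm computed
    from an arbitrarily chosen representative by that of any convenient variable. *)
Lemma cm_rep_le Z W : L2_span P b Z -> L2 P W ->
  (forall t : R, t \in `[0, 1] -> ip P (b t) Z = ip P (b t) W) ->
  ip P Z Z <= ip P W W.
Proof.
move=> [Z2 Zapp] W2 ZW.
suff ZZW : ip P Z Z <= ip P Z W.
  by have := @ip_quadratic _ _ _ P Z W 1 Z2 W2; lra.
set z := Num.sqrt (ip P Z Z); set w := Num.sqrt (ip P W W).
have zE : ip P Z Z = z ^+ 2 by rewrite sqr_sqrtr// ip_ge0.
have wE : ip P W W = w ^+ 2 by rewrite sqr_sqrtr// ip_ge0.
have z0 : 0 <= z by exact: sqrtr_ge0.
have w0 : 0 <= w by exact: sqrtr_ge0.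
apply/ler_addgt0Pr => e e0.
(* Cauchy-Schwarz turns an approximation error delta into delta z + delta w, which this choice keeps
   below e; the summand 1 prevents a division by 0. *)
have d0 : 0 < e / (z + w + 1) by rewrite divr_gt0// ltr_wpDl// addr_ge0.
have [n [c [t [t01]]]] := Zapp _ d0; rewrite mfun_sumE.
set S := \sum_(k < n) c k *: (b (t k) : T -> R) => hS.
have S2 : L2 P S by apply: L2_sum => k; apply/L2Z/fbm_L2.
have {}hS := L2_dist Z2 S2 (ltW d0) hS.
have D2 : L2 P ((Z : T -> R) - S) by exact: L2B.
have SZ : ip P S Z = ip P S W.
  rewrite !ip_suml//; try by move=> k; apply/L2Z/fbm_L2.
  by apply: eq_bigr => k _; rewrite !ipZl ?ZW//; exact: fbm_L2.
have h1 : `|ip P ((Z : T -> R) - S) Z| <= e / (z + w + 1) * z.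
  by apply: ip_CS_le => //; rewrite ?zE// ltW.
have h2 : `|ip P ((Z : T -> R) - S) W| <= e / (z + w + 1) * w.
  by apply: ip_CS_le => //; rewrite ?wE// ltW.
rewrite ipBl// SZ in h1; rewrite ipBl// in h2.
move: h1 h2 => /ler_normlP[_ h1] /ler_normlP[h2 _].
have : e / (z + w + 1) * z + e / (z + w + 1) * w <= e.
  have -> : e / (z + w + 1) * z + e / (z + w + 1) * w = e * ((z + w) / (z + w + 1)).
    by field; rewrite gt_eqF// ltr_wpDl// addr_ge0.
  rewrite ler_piMr ?(ltW e0)// ler_pdivrMr ?mul1r ?lerDl//.
  by rewrite ltr_wpDl// addr_ge0.
lra.
Qed.

Lemma fbm_incr_ip (u v x y : R) :
  u \in `[0, 1] -> v \in `[0, 1] -> x \in `[0, 1] -> y \in `[0, 1] ->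
  ip P ((b v : T -> R) - (b u : T -> R)) ((b y : T -> R) - (b x : T -> R)) =
  2^-1 * (`|v - x| `^ r + `|u - y| `^ r - `|v - y| `^ r - `|u - x| `^ r).
Proof.
move=> u01 v01 x01 y01.
have [hu hv hx hy] := And4 (fbm_L2 u01) (fbm_L2 v01) (fbm_L2 x01) (fbm_L2 y01).
have hxy := L2B hy hx.
rewrite ipBl// !(ipC _ _ (_ - _)) !ipBl// !fbm_ip//.
by rewrite (distrC y v) (distrC x v) (distrC y u) (distrC x u); lra.
Qed.

Section path.
Context (Z : {mfun T >-> R}) (h : R -> R) (m : R).
Hypothesis Z2 : L2 P Z.
Hypothesis hZ : forall t : R, t \in `[0, 1] -> h t = ip P (b t) Z.
Hypothesis m0 : 0 <= m.
Hypothesis Zm : ip P Z Z <= m ^+ 2.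

(** Cauchy-Schwarz, since the increment of b over [u, v] has variance |v - u|^(2H). Besides the
    variation for H > 1/2, it yields the regularity of the clock for every H. *)
Lemma cm_hoelder (u v : R) : u \in `[0, 1] -> v \in `[0, 1] ->
  `|h v - h u| <= m * `|v - u| `^ H.
Proof.
move=> u01 v01; rewrite !hZ// -ipBl//; try exact: fbm_L2.
rewrite mulrC; apply: ip_CS_le => //.
  by apply: L2B; exact: fbm_L2.
rewrite fbm_incr_ip// !subrr normr0 powR0; last by case/andP: H01; lra.
rewrite (distrC u v) -[leRHS]powR_mulrn ?powR_ge0// -powRrM mulrC (mulrC H).
lra.
Qed.

Lemma cm_weighted l : H <= 2^-1 -> itv_partition 0 1 l ->
  psum (fun u v => (h v - h u) ^+ 2 / (v - u) `^ r) 1 0 l <= 2 * m ^+ 2.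
Proof.
move=> H2 pl; have r0 : 0 < r by case/andP: H01; lra.
have r1 : r <= 1 by lra.
set n := size l; pose t k := nth 1 (0 :: l) k.
have t01 k : (k <= n)%N -> t k \in `[0, 1].
  move=> kn; rewrite in_itv/= (itv_partition_nth_ge _ pl)//=.
  by rewrite (itv_partition_nth_le _ pl).
have tlt i j : (i < j)%N -> (j <= n)%N -> t i < t j.
  move=> ij jn; have sl : sorted <%R (0 :: l) by case: pl.
  by rewrite lt_sorted_ltn_nth// inE/= ltnS// (leq_trans (ltnW ij)).
have tle i j : (i <= j)%N -> (j <= n)%N -> t i <= t j.
  by rewrite leq_eqVlt => /predU1P[->//|ij jn]; exact/ltW/tlt.
have tn : t n = 1 by exact: itv_partition_nth_size.
have t0 : t 0%N = 0 by [].
pose X (k : 'I_n) : T -> R := (b (t k.+1) : T -> R) - (b (t k) : T -> R).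
have X2 k : L2 P (X k) by apply: L2B; apply/fbm_L2/t01 => //; exact: ltnW.
pose D (k : 'I_n) := (t k.+1 - t k) `^ r.
have D0 k : 0 < D k by rewrite powR_gt0// subr_gt0 tlt.
pose K j k := ip P (X j) (X k).
have KC j k : K j k = K k j by exact: ipC.
have KE (j k : 'I_n) : K j k = 2^-1 * (`|t j.+1 - t k| `^ r + `|t j - t k.+1| `^ r
     - `|t j.+1 - t k.+1| `^ r - `|t j - t k| `^ r).
  by rewrite /K fbm_incr_ip// t01// ltnW.
have Kd k : K k k = D k.
  rewrite KE !subrr normr0 powR0 ?gt_eqF// (distrC (t k)) /D.
  by rewrite ger0_norm ?subr_ge0 ?tle//; lra.
(* For disjoint intervals the covariance is a second difference of the power 2H, with the gap
   between the intervals as the base point of [powR_cross_le]. *)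
have Kneg j k : j != k -> K j k <= 0.
  wlog jk : j k / (j < k)%N.
    move=> W jk; have [lt|gt] := ltnP j k; first exact: W.
    by rewrite KC W// 1?eq_sym// ltn_neqAle eq_sym jk.
  move=> _; have h1 : t j.+1 <= t k by rewrite tle// ltnW.
  have h2 : t j <= t j.+1 by exact: tle.
  have h3 : t k <= t k.+1 by exact: tle.
  rewrite KE !ler0_norm ?subr_le0//; try by [lra|exact: le_trans h1 h3].
  rewrite !opprB.
  have := @powR_cross_le _ r (t k - t j.+1) (t j.+1 - t j) (t k.+1 - t k) r0 r1.
  rewrite !subr_ge0 => /(_ h1 h2 h3).
  have -> : t k - t j.+1 + (t j.+1 - t j) + (t k.+1 - t k) = t k.+1 - t j by ring.
  have -> : t k - t j.+1 + (t j.+1 - t j) = t k - t j by ring.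
  have -> : t k - t j.+1 + (t k.+1 - t k) = t k.+1 - t j.+1 by ring.
  lra.
(* The row sum telescopes to the covariance of X_j with b_1 - b_0, which is half the increment of
   t^(2H) - (1 - t)^(2H), an increasing function. *)
have Ksum j : 0 <= \sum_k K j k.
  have -> : \sum_k K j k = ip P (X j) ((b (t n) : T -> R) - (b (t 0%N) : T -> R)).
    rewrite -(telescope_sumr (fun k => b (t k) : T -> R) (leq0n n)) big_mkord.
    by rewrite ipC ip_suml//; apply: eq_bigr => k _; rewrite ipC.
  rewrite fbm_incr_ip ?t01//; last exact: ltnW.
  rewrite tn t0 !subr0.
  have /andP[a0 a1] : 0 <= t j <= 1.
    by have := t01 j (ltnW (ltn_ord j)); rewrite in_itv.
  have /andP[c0 c1] : 0 <= t j.+1 <= 1 by have := t01 j.+1 (ltn_ord j); rewrite in_itv.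
  have ac : t j <= t j.+1 by exact: tle.
  rewrite (ger0_norm a0) (ger0_norm c0) !ler0_norm ?subr_le0// !opprB.
  have : t j `^ r <= t j.+1 `^ r by rewrite ge0_ler_powR ?nnegrE// ltW.
  have : (1 - t j.+1) `^ r <= (1 - t j) `^ r.
    by rewrite ge0_ler_powR ?nnegrE ?subr_ge0// ?(ltW r0)// lerB.
  lra.
(* The weights of the dual test variable [S]: with this choice E(S Z) is exactly [Q], and E(S^2) <=
   2 Q lets Cauchy-Schwarz close on [Q]. *)
pose beta (k : 'I_n) := (h (t k.+1) - h (t k)) / D k.
pose S : T -> R := \sum_k beta k *: X k.
have S2 : L2 P S by apply: L2_sum => k; exact: L2Z.
set Q := psum _ _ _ _.
have QE : Q = \sum_k beta k ^+ 2 * D k.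
  rewrite /Q /psum big_mkord; apply: eq_bigr => k _.
  by rewrite /beta -/(D k) expr_div_n; field; rewrite gt_eqF.
have Q0 : 0 <= Q.
  by rewrite QE; apply: sumr_ge0 => k _; rewrite mulr_ge0 ?sqr_ge0// ltW.
have SZ : ip P S Z = Q.
  rewrite ip_suml//; last by move=> k; exact: L2Z.
  rewrite QE; apply: eq_bigr => k _; rewrite ipZl// ipBl//;
    try by apply/fbm_L2/t01 => //; exact: ltnW.
  rewrite -!hZ; try by apply: t01 => //; exact: ltnW.
  by rewrite /beta expr_div_n; field; rewrite gt_eqF.
have SS : ip P S S <= 2 * Q.
  have -> : ip P S S = \sum_j \sum_k beta j * beta k * K j k.
    rewrite ip_suml//; last by move=> k; exact: L2Z.
    apply: eq_bigr => j _; rewrite ipZl// ipC ip_suml//; last by move=> k; exact: L2Z.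
    by rewrite big_distrr/=; apply: eq_bigr => k _; rewrite ipZl// ipC mulrA.
  (* Off the diagonal, K_jk <= 0 allows beta_j beta_k to be replaced by -(beta_j^2 + beta_k^2) / 2;
     on the diagonal there is equality as K_jj = D_j. The two subtracted sums then consist of
     nonnegative row sums. *)
  have : \sum_j \sum_k beta j * beta k * K j k <= \sum_j \sum_k
      ((if j == k then 2 * beta j ^+ 2 * D j else 0)
       - 2^-1 * (beta j ^+ 2 * K j k) - 2^-1 * (beta k ^+ 2 * K k j)).
    apply: ler_sum => j _; apply: ler_sum => k _; rewrite (KC k j).
    case: eqVneq => [->|jk]; first by rewrite Kd; lra.
    have := mulr_ge0_le0 (sqr_ge0 (beta j + beta k)) (Kneg _ _ jk); lra.
  move=> /le_trans; apply.
  under eq_bigr => j _ do rewrite !sumrB.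
  rewrite !sumrB [X in _ - X]exchange_big/=.
  have -> : \sum_j \sum_k (if j == k then 2 * beta j ^+ 2 * D j else 0) = 2 * Q.
    rewrite QE big_distrr/=; apply: eq_bigr => j _.
    rewrite -big_mkcond/= (big_pred1 j) ?mulrA//.
  have : 0 <= \sum_j \sum_k 2^-1 * (beta j ^+ 2 * K j k).
    apply: sumr_ge0 => j _; rewrite -mulr_sumr -mulr_sumr.
    by rewrite mulr_ge0// mulr_ge0 ?sqr_ge0.
  lra.
have : Q ^+ 2 <= 2 * Q * m ^+ 2.
  rewrite -{1}SZ; apply: le_trans (ip_CS S2 Z2) _.
  by rewrite ler_pM ?ip_ge0.
move: Q0; rewrite le_eqVlt => /predU1P[<- _|Q0]; first by rewrite mulr_ge0 ?sqr_ge0.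
have -> : 2 * Q * m ^+ 2 = Q * (2 * m ^+ 2) by ring.
by rewrite [Q ^+ 2]expr2 ler_pM2l.
Qed.

End path.
End cameron_martin.

Lemma cm_variation (disp : measure_display) (T : measurableType disp)
    (R : realType) (P : probability T R) (H : R) : 0 < H < 1 ->
  exists q C : R, [/\ 1 <= q < 2, 0 < C &
    forall (b : R -> {mfun T >-> R}) (Z : {mfun T >-> R}) (h : R -> R) (m : R),
      (forall s t : R, s \in `[0, 1] -> t \in `[0, 1] ->
        'E_P[b s \* b t]%E =
        (2^-1 * (s `^ (2 * H) + t `^ (2 * H) - `|s - t| `^ (2 * H)))%:E) ->
      L2 P Z -> (forall t : R, t \in `[0, 1] -> h t = ip P (b t) Z) ->
      0 < m -> ip P Z Z <= m ^+ 2 ->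
      bounded_variation_on (fun u v => `|h v - h u| `^ q) 0 1 (C * m `^ q)].
Proof.
move=> H01; have [H0 H1] := andP H01.
have in01 u v : 0 <= u -> u < v -> v <= 1 -> (u \in `[0, 1]) /\ (v \in `[0, 1 : R]).
  by move=> u0 uv v1; rewrite !in_itv/= u0 v1 (ltW (lt_le_trans uv v1)) (le_trans u0 (ltW uv)).
have [H2|H2] := leP H 2^-1.
  (* Chosen so that (v - u)^(2 H theta) = (v - u)^(1 - theta): the q-th power of an increment
     becomes a weighted geometric mean of its weighted square and of v - u. The constant 3 adds the
     bound 2 of [cm_weighted] and the length 1. *)
  set theta := (1 + 2 * H)^-1.
  have th0 : 0 < theta by rewrite invr_gt0; lra.
  have thE : theta * (1 + 2 * H) = 1 by rewrite mulVf//; lra.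
  have th1 : theta < 1 by rewrite invf_lt1//; lra.
  exists (2 * theta), 3; split => //.
    apply/andP; split; last by lra.
    have : theta * (1 + 2 * H) <= theta * 2 by rewrite ler_wpM2l ?(ltW th0)//; lra.
    lra.
  move=> b Z h m b_cov Z2 hZ m0 Zm l pl.
  pose F u v := (h v - h u) ^+ 2 / (v - u) `^ (2 * H).
  have FW : psum F 1 0 l <= 2 * m ^+ 2 := cm_weighted H01 b_cov Z2 hZ Zm H2 pl.
  apply: (@le_trans _ _ (psum (fun u v => m `^ (2 * theta) * (F u v / m ^+ 2 + (v - u))) 1 0 l)).
    apply: psum_le pl => u v u0 uv v1.
    have D0 : 0 < v - u by rewrite subr_gt0.
    have F0 : 0 <= F u v by rewrite divr_ge0 ?sqr_ge0 ?powR_ge0.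
    have m2 : 0 < m ^+ 2 by rewrite exprn_gt0.
    set X := F u v / m ^+ 2; have X0 : 0 <= X by rewrite divr_ge0// ltW.
    have -> : `|h v - h u| `^ (2 * theta) =
        m `^ (2 * theta) * (X `^ theta * (v - u) `^ (1 - theta)).
      have -> : 1 - theta = 2 * H * theta by lra.
      rewrite (powRrM m) powR_mulrn ?(ltW m0)// mulrA -powRM ?(ltW m2)//.
      rewrite [m ^+ 2 * X]mulrC /X divfK ?gt_eqF// (powRrM (v - u)) -powRM ?powR_ge0//.
      rewrite /F divfK ?gt_eqF ?powR_gt0// powRrM powR_mulrn//.
      by rewrite real_normK ?num_real.
    rewrite ler_wpM2l ?powR_ge0//.
    have s0 : 0 < X + (v - u) by rewrite ltr_wpDl.
    (* The weighted geometric mean is bounded crudely by the sum of its two entries. *)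
    apply: (@le_trans _ _ ((X + (v - u)) `^ theta * (X + (v - u)) `^ (1 - theta))).
      rewrite ler_pM ?powR_ge0// ge0_ler_powR ?nnegrE ?(ltW th0) ?(ltW s0) ?(ltW D0)//.
      - by rewrite lerDl ltW.
      - by rewrite subr_ge0 ltW.
      - by rewrite lerDr.
    have tE : theta + (1 - theta) = 1 by ring.
    by rewrite -powRD ?(gt_eqF s0) ?implybT// tE powRr1// ltW.
  rewrite {1}/psum -mulr_sumr big_split/= -mulr_suml mulrC.
  rewrite ler_wpM2r ?powR_ge0//.
  have := psum_tele (fun u : R => u) pl; rewrite subr0 /psum => ->.
  have : psum F 1 0 l / m ^+ 2 <= 2 by rewrite ler_pdivrMr ?exprn_gt0.
  by rewrite /psum; lra.
exists H^-1, 3; split => //.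
  by rewrite invf_ge1// (ltW H1)/= -[ltRHS]invrK ltf_pV2 ?posrE.
move=> b Z h m b_cov Z2 hZ m0 Zm l pl.
apply: (@le_trans _ _ (psum (fun u v => m `^ H^-1 * (v - u)) 1 0 l)).
  apply: psum_le pl => u v u0 uv v1.
  have [u01 v01] := in01 u v u0 uv v1.
  have D0 : 0 < v - u by rewrite subr_gt0.
  have hh := cm_hoelder H01 b_cov Z2 hZ (ltW m0) Zm u01 v01.
  apply: le_trans (ge0_ler_powR _ _ _ hh) _; rewrite ?nnegrE ?invr_ge0 ?(ltW H0)//.
    by rewrite mulr_ge0 ?powR_ge0// ltW.
  rewrite powRM ?powR_ge0 ?(ltW m0)// -powRrM divff ?gt_eqF// powRr1//.
  by rewrite ger0_norm// ltW.
rewrite {1}/psum -mulr_sumr.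
have := psum_tele (fun u : R => u) pl; rewrite subr0 /psum => ->.
by rewrite mulr1 ler_peMl ?powR_ge0//; lra.
Qed.

Lemma norm_le_enorm (R : realType) (N : nat) (v : 'cV[R]_N) : `|v| <= enorm v.
Proof.
rewrite [`|v|]mx_normrE; apply: bigmax_le => [|[i j] _]; first exact: sqrtr_ge0.
rewrite /= (ord1 j) -sqrtr_sqr ler_wsqrtr// (bigD1 i)//= lerDl.
by apply: sumr_ge0 => k _; exact: sqr_ge0.
Qed.

Lemma norm_coord (R : realType) (N : nat) (v : 'cV[R]_N) k : `|v k 0| <= `|v|.
Proof.
rewrite [`|v|]mx_normrE.
exact: (le_bigmax _ (fun i : 'I_N * 'I_1 => `|v i.1 i.2|) (k, 0)).
Qed.

Lemma norm_le_coord (R : realType) (N : nat) (v : 'cV[R]_N) (c : R) :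
  0 <= c -> (forall k, `|v k 0| <= c) -> `|v| <= c.
Proof.
move=> c0 vc; rewrite [`|v|]mx_normrE; apply: bigmax_le => // -[i j] _.
by rewrite /= (ord1 j).
Qed.

Lemma enorm_le_norm (R : realType) (N : nat) (v : 'cV[R]_N) :
  enorm v <= N%:R * `|v|.
Proof.
have Nv : 0 <= N%:R * `|v| by rewrite mulr_ge0.
rewrite -[leRHS]ger0_norm// -sqrtr_sqr ler_wsqrtr//.
apply: (@le_trans _ _ (N%:R * `|v| ^+ 2)).
  have -> : N%:R * `|v| ^+ 2 = \sum_(k < N) `|v| ^+ 2.
    by rewrite sumr_const card_ord mulr_natl.
  apply: ler_sum => k _.
  by rewrite -[leLHS]real_normK ?num_real// lerXn2r ?nnegrE ?norm_coord.
rewrite exprMn ler_wpM2r ?sqr_ge0// -natrX ler_nat -mulnn; nia.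
Qed.

(** * Displacement of a solution in terms of the Cameron-Martin norm of its driver *)

Section lower_bound.
Context (disp : measure_display) (T : measurableType disp) (R : realType).
Context (P : probability T R) (H : R) (N d : nat).
Context (B : 'I_d -> R -> {mfun T >-> R}) (V : 'I_d -> 'cV[R]_N -> 'cV[R]_N).
Context (M L : R).
Hypothesis H01 : 0 < H < 1.
Hypothesis B_fBm : is_fBm P H B.
Hypothesis M0 : 0 <= M.
Hypothesis L0 : 0 <= L.
Hypothesis VM : forall i z, `|V i z| <= M.
Hypothesis VL : forall i z1 z2, `|V i z1 - V i z2| <= L * `|z1 - z2|.

Lemma fbm_cov i (s t : R) : s \in `[0, 1] -> t \in `[0, 1] ->
  'E_P[B i s \* B i t]%E =
  (2^-1 * (s `^ (2 * H) + t `^ (2 * H) - `|s - t| `^ (2 * H)))%:E.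
Proof.
by move=> s01 t01; case: B_fBm => _ _ -> // _; rewrite eqxx mulr1.
Qed.

Lemma cm_rep_represents i h : cm_space P B h ->
  cm_represents P (B i) (h i) (cm_rep P (B i) (h i)).
Proof. by move=> /(_ i) [Z hZ]; rewrite /cm_rep; apply: xgetPex; exists Z. Qed.

Lemma cm_represents_ip i h Z (t : R) : cm_represents P (B i) h Z -> t \in `[0, 1] ->
  h t = ip P (B i t) Z.
Proof. by move=> [_ hZ] t01; rewrite /ip -hZ. Qed.

Lemma solution_displacement : exists K eps : R, [/\ 0 <= K, 0 < eps &
  forall h x phi, cm_space P B h -> is_young_solution V h x phi ->
    cm_norm P B h < eps -> `|phi 1 - x| <= K * cm_norm P B h].
Proof.
have [q [C [q12 C0 var]]] := cm_variation P H01.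
have q0 : 0 < q by case/andP: q12; lra.
pose G := (d%:R * C) `^ q^-1.
have G0 : 0 <= G by exact: powR_ge0.
pose E := d%:R * (sewing_cst (2 / q) * 2 `^ (2 / q) * L) * G.
have E0 : 0 <= E.
  have c0 : 0 <= sewing_cst (2 / q).
    rewrite divr_ge0// ltW// sewing_denominator_gt0// ltr_pdivlMr// mul1r.
    by case/andP: q12.
  rewrite /E mulr_ge0// mulr_ge0// mulr_ge0// mulr_ge0// ?powR_ge0//.
(* [E m] is the quantity required to be at most 1/2 in [young_solution_bound] when the driver has
   norm at most m; the summand 1 covers E = 0. *)
have eps0 : 0 < (2 * (E + 1))^-1 by rewrite invr_gt0; lra.
pose K := 2 * d%:R * M * G.
have K0 : 0 <= K by rewrite /K !mulr_ge0.
exists K, (2 * (E + 1))^-1; split => //.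
move=> h x phi hB sol; set nh := cm_norm P B h => nh_eps.
have nh0 : 0 <= nh by exact: sqrtr_ge0.
(* A positive m above the norm replaces the norm, which may vanish, because [cm_variation] divides
   by m; m is sent down to the norm afterwards. *)
have key m : 0 < m -> nh <= m -> m <= (2 * (E + 1))^-1 -> `|phi 1 - x| <= K * m.
  move=> m0 nm me; have GE : (d%:R * (C * m `^ q)) `^ q^-1 = G * m.
    rewrite mulrA powRM ?mulr_ge0 ?powR_ge0 ?(ltW C0)// -powRrM divff ?gt_eqF//.
    by rewrite powRr1// ltW.
  have hS i : bounded_variation_on (fun u v => `|h i v - h i u| `^ q) 0 1 (C * m `^ q).
    have rep := cm_rep_represents i hB.
    apply: (var (B i) (cm_rep P (B i) (h i))) => //.
    - exact: fbm_cov.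
    - by case: rep => -[].
    - by move=> t; exact: cm_represents_ip rep.
    - have : nh ^+ 2 <= m ^+ 2 by rewrite lerXn2r ?nnegrE// ltW.
      apply: le_trans; rewrite sqr_sqrtr; last first.
        by apply: sumr_ge0 => j _; exact: ip_ge0.
      rewrite /cm_inner (bigD1 i)//= lerDl.
      by apply: sumr_ge0 => j _; exact: ip_ge0.
  have := young_solution_bound M0 L0 VM VL q12 hS sol.
  rewrite GE => bnd; apply: le_trans (bnd _) _; last by rewrite /K !mulrA.
  rewrite mulrA -/E; apply: (@le_trans _ _ (E * (2 * (E + 1))^-1)).
    by rewrite ler_wpM2l.
  by rewrite ler_pdivrMr ?mulr_gt0//; lra.
apply/ler_addgt0Pr => e e0.
have e1 : 0 < e / (K + 1) by rewrite divr_gt0// ltr_wpDl.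
(* If the enlarged value passes the threshold, the threshold itself lies between the norm and that
   value and can be used as m. *)
have [le|gt] := leP (nh + e / (K + 1)) (2 * (E + 1))^-1.
  apply: le_trans (key _ _ _ le) _; first by rewrite ltr_wpDl.
    by rewrite lerDl ltW.
  rewrite mulrDr lerD2l mulrCA ler_piMr ?(ltW e0)// ler_pdivrMr ?mul1r; last by rewrite ltr_wpDl.
  by rewrite lerDl.
apply: le_trans (key _ eps0 (ltW nh_eps) (lexx _)) _.
apply: (@le_trans _ _ (K * (nh + e / (K + 1)))); first by rewrite ler_wpM2l// ltW.
rewrite mulrDr lerD2l mulrCA ler_piMr ?(ltW e0)// ler_pdivrMr ?mul1r; last by rewrite ltr_wpDl.
by rewrite lerDl.
Qed.

End lower_bound.

(** * Primitives of Lipschitz functions *)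

Lemma hoelder_continuous (R : realType) (U : normedModType R) (a b K alpha : R)
    (f : R -> U) : 0 < alpha ->
  (forall u v : R, u \in `[a, b] -> v \in `[a, b] ->
     `|f v - f u| <= K * `|v - u| `^ alpha) ->
  {within `[a, b], continuous f}.
Proof.
move=> al0 fK; apply/subspace_continuousP => x xab.
have K1 : 0 < `|K| + 1 by rewrite ltr_wpDl.
apply/cvgrPdist_le => e e0; near=> t.
have tab : t \in `[a, b] by near: t; exact: withinT.
apply: le_trans (fK t x tab xab) _.
have h : `|x - t| `^ alpha <= e / (`|K| + 1).
  have -> : e / (`|K| + 1) = ((e / (`|K| + 1)) `^ alpha^-1) `^ alpha.
    by rewrite -powRrM mulVf ?gt_eqF// powRr1// divr_ge0// ltW.
  rewrite ge0_ler_powR ?nnegrE ?powR_ge0// ?(ltW al0)// ltW//.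
  near: t; apply: cvg_within.
  by apply: nbhsx_ballx; rewrite powR_gt0// divr_gt0.
apply: (@le_trans _ _ ((`|K| + 1) * `|x - t| `^ alpha)).
  by rewrite ler_wpM2r ?powR_ge0//; have := ler_norm K; lra.
by rewrite mulrC -ler_pdivlMr.
Unshelve. all: by end_near. Qed.

Lemma lipschitz_continuous (R : realType) (U : normedModType R) (a b K : R)
    (f : R -> U) :
  (forall u v : R, u \in `[a, b] -> v \in `[a, b] -> `|f v - f u| <= K * `|v - u|) ->
  {within `[a, b], continuous f}.
Proof.
move=> fK; apply: (@hoelder_continuous _ _ _ _ K 1) => // u v uab vab.
by rewrite powRr1// fK.
Qed.

Section primitive.
Context (R : realType).
Local Notation mu := (@lebesgue_measure R).

Lemma lipschitz_integrable (f : R -> R) (K : R) :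
  (forall u v : R, u \in `[0, 1] -> v \in `[0, 1] -> `|f v - f u| <= K * `|v - u|) ->
  mu.-integrable `[0, 1] (EFin \o f).
Proof.
move=> fK; apply: continuous_compact_integrable; first exact: segment_compact.
exact: lipschitz_continuous fK.
Qed.

Lemma Rintegral_increment (f : R -> R) (u v : R) :
  mu.-integrable `[0, 1] (EFin \o f) -> 0 <= u -> u <= v -> v <= 1 ->
  \int[mu]_(x in `[0, v]) f x - \int[mu]_(x in `[0, u]) f x
  = \int[mu]_(x in `]u, v]) f x.
Proof.
move=> fi u0 uv v1; rewrite Rintegral_itvB ?bnd_simp//.
by apply: integrableS fi => //; apply: subset_itvl; rewrite bnd_simp.
Qed.

Lemma Rintegral_increment_dist (f g : R -> R) (u v e : R) :
  mu.-integrable `[0, 1] (EFin \o f) -> mu.-integrable `[0, 1] (EFin \o g) ->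
  0 <= u -> u <= v -> v <= 1 ->
  (forall t, u <= t -> t <= v -> `|f t - g t| <= e) ->
  `|(\int[mu]_(x in `[0, v]) f x - \int[mu]_(x in `[0, u]) f x)
    - (\int[mu]_(x in `[0, v]) g x - \int[mu]_(x in `[0, u]) g x)|
  <= e * (v - u).
Proof.
move=> fi gi u0 uv v1 fg.
have sub : `]u, v] `<=` `[0, 1 : R].
  by apply: subset_itv; rewrite bnd_simp.
have fi' : mu.-integrable `]u, v] (EFin \o f) by exact: integrableS fi.
have gi' : mu.-integrable `]u, v] (EFin \o g) by exact: integrableS gi.
have fgi : mu.-integrable `]u, v] (EFin \o (fun x => f x - g x)).
  have : mu.-integrable `]u, v] ((EFin \o f) \- (EFin \o g))%E by exact: integrableB.
  exact.
rewrite (Rintegral_increment fi u0 uv v1) (Rintegral_increment gi u0 uv v1) -RintegralB//.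
apply: le_trans (le_normr_Rintegral _ _) _ => //.
apply: le_trans (@le_Rintegral _ _ _ mu _ _ (cst e) _ _ _ _) _ => //.
- exact: integrable_norm.
- have ei : mu.-integrable `[0, 1] (EFin \o (cst e : R -> R)).
    by apply: (@lipschitz_integrable _ 0) => ? ? _ _; rewrite subrr normr0 mul0r.
  exact: integrableS ei.
- by move=> x; rewrite /= in_itv/= => /andP[ux xv]; rewrite fg// ltW.
rewrite Rintegral_cst//= lebesgue_measure_itv/= lte_fin.
by case: ltP => // uv'; have -> : v - u = 0 by lra.
Qed.

Definition prim (N : nat) (F : R -> 'cV[R]_N) (s : R) : 'cV[R]_N :=
  \col_k \int[mu]_(x in `[0, s]) (F x k 0).

Lemma prim0 (N : nat) (F : R -> 'cV[R]_N) : prim F 0 = 0.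
Proof. by apply/colP => k; rewrite !mxE set_itv1 Rintegral_set1. Qed.

Definition lipschitz01 (N : nat) (F : R -> 'cV[R]_N) : Prop :=
  exists K : R, forall u v : R, u \in `[0, 1] -> v \in `[0, 1] ->
    `|F v - F u| <= K * `|v - u|.

Lemma lipschitz01_integrable (N : nat) (F : R -> 'cV[R]_N) k : lipschitz01 F ->
  mu.-integrable `[0, 1] (EFin \o (fun x => F x k 0)).
Proof.
move=> [K FK]; apply: (@lipschitz_integrable _ K) => u v u01 v01.
apply: le_trans (FK u v u01 v01); have := norm_coord (F v - F u) k.
by rewrite !mxE.
Qed.

Lemma prim_dist (N : nat) (F G : R -> 'cV[R]_N) (u v e : R) :
  lipschitz01 F -> lipschitz01 G -> 0 <= u -> u <= v -> v <= 1 -> 0 <= e ->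
  (forall t, u <= t -> t <= v -> `|F t - G t| <= e) ->
  `|(prim F v - prim F u) - (prim G v - prim G u)| <= e * (v - u).
Proof.
move=> hF hG u0 uv v1 e0 FG; apply: norm_le_coord.
  by rewrite mulr_ge0// subr_ge0.
move=> k; rewrite !mxE; apply: Rintegral_increment_dist => //.
- exact: lipschitz01_integrable.
- exact: lipschitz01_integrable.
- move=> t ut tv; apply: le_trans (FG t ut tv).
  by have := norm_coord (F t - G t) k; rewrite !mxE.
Qed.

Lemma lipschitz01_cst (N : nat) (c : 'cV[R]_N) : lipschitz01 (fun=> c).
Proof. by exists 0 => u v _ _; rewrite subrr normr0 mul0r. Qed.

Lemma prim_cst (N : nat) (c : 'cV[R]_N) (u : R) : 0 <= u ->
  prim (fun=> c) u = u *: c.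
Proof.
move=> u0; apply/colP => k; rewrite !mxE Rintegral_cst//= lebesgue_measure_itv/= lte_fin.
by case: ltP => [_|u0']; rewrite /= ?subr0 1?mulrC//; have -> : u = 0 by lra; rewrite mulr0.
Qed.

Lemma primD (N : nat) (F G : R -> 'cV[R]_N) (s : R) :
  lipschitz01 F -> lipschitz01 G -> 0 <= s -> s <= 1 ->
  prim (fun u => F u + G u) s = prim F s + prim G s.
Proof.
move=> hF hG s0 s1; apply/colP => k; rewrite !mxE.
have sub : `[0, s] `<=` `[0, 1 : R] by apply: subset_itvl; rewrite bnd_simp.
rewrite -RintegralD//.
- by apply: eq_Rintegral => u _; rewrite mxE.
- exact: integrableS (lipschitz01_integrable k hF).
- exact: integrableS (lipschitz01_integrable k hG).
Qed.

Lemma prim_approx (N : nat) (F : R -> 'cV[R]_N) (u v e : R) (c : 'cV[R]_N) :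
  lipschitz01 F -> 0 <= u -> u <= v -> v <= 1 -> 0 <= e ->
  (forall t, u <= t -> t <= v -> `|F t - c| <= e) ->
  `|prim F v - prim F u - (v - u) *: c| <= e * (v - u).
Proof.
move=> hF u0 uv v1 e0 Fc.
have := prim_dist hF (lipschitz01_cst c) u0 uv v1 e0 Fc.
by rewrite !prim_cst// ?(le_trans u0 uv)// -scalerBl.
Qed.

End primitive.

(** The explicit rate is what lets estimates on the iterates pass to the limit through
    [le_add_half_pow]. *)
Lemma geometric_limit (R : realType) (N : nat) (u : nat -> 'cV[R]_N) (A : R) :
  0 <= A -> (forall n, `|u n.+1 - u n| <= A / 2 ^+ n) ->
  exists l, forall n, `|l - u n| <= 2 * A / 2 ^+ n.
Proof.
move=> A0 uA.
(* Subtracting the tail of the geometric series makes the bound inductive in k. *)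
have step n k : `|u (n + k)%N - u n| <= 2 * A / 2 ^+ n - 2 * A / 2 ^+ (n + k).
  elim: k => [|k IH]; first by rewrite addn0 !subrr normr0.
  rewrite addnS -(subrKA (u (n + k)%N)).
  apply: le_trans (ler_normD _ _) _.
  apply: le_trans (lerD (uA _) IH) _.
  have -> : 2 * A / 2 ^+ (n + k).+1 = A / 2 ^+ (n + k).
    by rewrite exprS; field; rewrite expf_neq0.
  have -> : 2 * A / 2 ^+ (n + k) = A / 2 ^+ (n + k) + A / 2 ^+ (n + k) by ring.
  lra.
have bound n k : `|u (n + k)%N - u n| <= 2 * A / 2 ^+ n.
  apply: le_trans (step n k) _; rewrite gerBl divr_ge0 ?mulr_ge0//.
have cu : cvgn u.
  apply/cauchy_cvgP/cauchy_exP => e e0.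
  have n_gt := archi_boundP (normr_ge0 (2 * A / e)).
  set n := Num.bound _ in n_gt; exists (u n); exists n => //= k nk.
  rewrite -ball_normE/= distrC -(subnKC nk); apply: le_lt_trans (bound _ _) _.
  rewrite ltr_pdivrMr ?exprn_gt0// [ltRHS]mulrC -ltr_pdivrMr//.
  apply: le_lt_trans (ler_norm _) _; apply: lt_trans n_gt _.
  by rewrite -natrX ltr_nat ltn_expl.
exists (lim (u @ \oo)) => n; apply/ler_addgt0Pr => e e0.
have /cvgrPdist_lt/(_ _ e0) [k _ kP] := cu.
have := kP (n + k)%N (leq_addl _ _) => /= h.
rewrite -(subrKA (u (n + k)%N)).
apply: le_trans (ler_normD _ _) _.
by rewrite [leLHS]addrC; apply: lerD (bound n k) (ltW h).
Qed.

(** * Steering along a flow *)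

Lemma lipschitz01_of_increments (R : realType) (N : nat) (F : R -> 'cV[R]_N) (K : R) :
  (forall u v, 0 <= u -> u <= v -> v <= 1 -> `|F v - F u| <= K * (v - u)) ->
  forall u v, u \in `[0, 1] -> v \in `[0, 1] -> `|F v - F u| <= K * `|v - u|.
Proof.
move=> FK; have main u v : 0 <= u -> u <= v -> v <= 1 -> `|F v - F u| <= K * `|v - u|.
  by move=> u0 uv v1; rewrite (@ger0_norm _ (v - u)) ?subr_ge0// FK.
move=> u v; rewrite !in_itv/= => /andP[u0 u1] /andP[v0 v1].
have [uv|/ltW vu] := leP u v; first exact: main.
by rewrite distrC (distrC v); exact: main.
Qed.

Section steering.
Context (R : realType) (N : nat) (W : 'cV[R]_N -> 'cV[R]_N -> 'cV[R]_N).
Context (x y : 'cV[R]_N) (L w : R).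
Hypothesis L0 : 0 <= L.
Hypothesis w0 : 0 <= w.
Hypothesis Wlin : forall z b b', W z (b - b') = W z b - W z b'.
Hypothesis Wbound : forall z b, `|W z b| <= w * `|b|.
Hypothesis Wlip : forall z z' b, `|W z b - W z' b| <= L * `|z - z'| * `|b|.
(** Normalization at the starting point: to first order the parameter b moves x to x + b. *)
Hypothesis Wx : forall b, W x b = b.

Local Notation eta := `|y - x|.
Local Notation beta := (2 * eta).
(** The thresholds 1/4 and 1/10 are what [contraction] needs in order to halve: 4 L beta + 1 <= 2
    for the trajectory, 5 L beta w <= 1/2 for the parameter. *)
Hypothesis small1 : L * beta <= 4^-1.
Hypothesis small2 : L * beta * w <= 10^-1.

(* Newton's method for the parameter [b] and Picard's iteration for the
   trajectory, run simultaneously. *)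
Fixpoint picard (n : nat) : (R -> 'cV[R]_N) * 'cV[R]_N :=
  if n is n'.+1 then
    let psi := fun s => x + prim (fun u => W ((picard n').1 u) (picard n').2) s in
    (psi, (picard n').2 + (y - psi 1))
  else (fun=> x, 0).

Local Notation psi n := (picard n).1.
Local Notation par n := (picard n).2.

Let eta0 : 0 <= eta. Proof. exact: normr_ge0. Qed.

Let W_dist z z' b b' :
  `|W z b - W z' b'| <= L * `|z - z'| * `|b'| + w * `|b - b'|.
Proof.
have -> : W z b - W z' b' = (W z b' - W z' b') + W z (b - b').
  by rewrite Wlin [RHS]addrC subrKA.
exact: le_trans (ler_normD _ _) (lerD (Wlip _ _ _) (Wbound _ _)).
Qed.

Let Wle z b : `|b| <= beta -> `|W z b| <= w * beta.
Proof. by move=> hb; apply: le_trans (Wbound _ _) _; rewrite ler_wpM2l. Qed.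

Let lipschitz_W F b : lipschitz01 F -> lipschitz01 (fun u => W (F u) b).
Proof.
move=> [K FK]; exists (L * K * `|b|) => u v u01 v01.
apply: le_trans (Wlip _ _ _) _; rewrite [leRHS]mulrAC.
by rewrite ler_wpM2r// -mulrA ler_wpM2l// FK.
Qed.

Let in01 (u : R) : 0 <= u -> u <= 1 -> u \in `[0, 1].
Proof. by move=> u0 u1; rewrite in_itv/= u0. Qed.

(** The radius beta = 2 eta is stable: the new parameter is y - x minus the deviation of the
    endpoint from x + b, and this deviation is at most L w beta^2 <= beta / 10 <= eta. *)
Let invariant n :
  [/\ `|par n| <= beta, psi n 0 = x &
      forall u v, 0 <= u -> u <= v -> v <= 1 ->
        `|psi n v - psi n u| <= w * beta * (v - u)].
Proof.
have wb0 : 0 <= w * beta by rewrite mulr_ge0// mulr_ge0.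
elim: n => [|n [hb h0 hl]] /=.
  split; first by rewrite normr0 mulr_ge0.
    by [].
  by move=> u v _ uv _; rewrite subrr normr0 mulr_ge0// subr_ge0.
have lipn : lipschitz01 (psi n).
  exists (w * beta); exact: lipschitz01_of_increments hl.
have lipF := lipschitz_W (par n) lipn.
set F := fun u => W _ _ in lipF *.
split.
- have -> : par n + (y - (x + prim F 1)) =
     (y - x) - (prim F 1 - prim F 0 - (1 - 0) *: par n).
    rewrite prim0 !subr0 scale1r !(opprD, opprK, addrA).
    by rewrite (ACl (2*3*4*1))/=.
  apply: le_trans (ler_normB _ _) _.
  have -> : beta = eta + eta by ring.
  rewrite lerD2l; apply: (@le_trans _ _ (L * (w * beta) * beta * (1 - 0))).
    apply: prim_approx => //; first by rewrite !mulr_ge0.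
    move=> t t0 t1; rewrite /F -[X in _ - X]Wx.
    apply: le_trans (Wlip _ _ _) _; rewrite ler_pM ?mulr_ge0// ler_wpM2l//.
    have := hl 0 t (lexx _) t0 t1; rewrite h0 subr0 => /le_trans; apply.
    by rewrite ler_piMr.
  rewrite subr0 mulr1.
  have -> : L * (w * beta) * beta = (L * beta * w) * beta by ring.
  apply: le_trans (ler_wpM2r _ small2) _; first by rewrite mulr_ge0.
  by have := eta0; lra.
- by rewrite prim0 addr0.
- move=> u v u0 uv v1; rewrite opprD addrACA subrr add0r.
  have := @prim_approx _ _ F u v (w * beta) 0 lipF u0 uv v1 wb0.
  rewrite scaler0 subr0; apply => t _ _; rewrite subr0; exact: Wle.
Qed.

Let par_le n : `|par n| <= beta. Proof. by case: (invariant n). Qed.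

Let psi_lip n : lipschitz01 (psi n).
Proof.
have [_ _ hl] := invariant n.
by exists (w * beta); exact: lipschitz01_of_increments hl.
Qed.

Let psi_near n t : 0 <= t -> t <= 1 -> `|psi n t - x| <= w * beta.
Proof.
move=> t0 t1; have [_ h0 hl] := invariant n.
have := hl 0 t (lexx _) t0 t1; rewrite h0 subr0 => /le_trans; apply.
by rewrite ler_piMr// mulr_ge0// mulr_ge0.
Qed.

Let parS n : par n.+1 = par n + (y - psi n.+1 1). Proof. by []. Qed.

Let psiS n t :
  psi n.+1 t = x + prim (fun u => W (psi n u) (par n)) t.
Proof. by []. Qed.

(** The two bounds feed each other. A parameter change c moves the endpoint by c up to an error, and
    the correction removes exactly c; what remains carries the small factor L beta w. *)
Let contraction n :
  (forall t, 0 <= t -> t <= 1 -> `|psi n.+1 t - psi n t| <= 4 * w * eta / 2 ^+ n) /\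
  `|par n.+1 - par n| <= eta / 2 ^+ n.
Proof.
elim: n => [|n [hD hE]].
  (* The initial parameter is 0, so the first Picard step does not move and the first correction is
     y - x. *)
  have ctr t : 0 <= t -> psi 1 t = x.
    move=> t0.
    have W0 z : W z 0 = 0 by have := Wlin z 0 0; rewrite !subrr.
    rewrite /= (_ : (fun u => W x 0) = (fun=> 0)); last by apply/funext => u; rewrite W0.
    by rewrite prim_cst// scaler0 addr0.
  split; first by move=> t t0 _; rewrite ctr// subrr normr0 expr0 divr1 !mulr_ge0.
  by rewrite parS ctr// add0r subr0 expr0 divr1.
set p := 2 ^+ n in hD hE; have p0 : 0 < p by rewrite exprn_gt0.
have e0 : 0 <= eta / p by rewrite divr_ge0// ltW.
have pS : 2 ^+ n.+1 = 2 * p by rewrite exprS.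
have F1 := lipschitz_W (par n.+1) (psi_lip n.+1).
have F2 := lipschitz_W (par n) (psi_lip n).
have diff t : 0 <= t -> t <= 1 ->
    `|psi n.+2 t - psi n.+1 t| <= 4 * w * eta / 2 ^+ n.+1.
  move=> t0 t1.
  have c0 : 0 <= L * (4 * w * eta / p) * beta + w * (eta / p).
    by rewrite addr_ge0// !mulr_ge0// invr_ge0 ltW.
  have := prim_dist F1 F2 (lexx 0) t0 t1 c0.
  rewrite !prim0 !subr0 => H.
  have -> : psi n.+2 t - psi n.+1 t =
     prim (fun u => W (psi n.+1 u) (par n.+1)) t - prim (fun u => W (psi n u) (par n)) t.
    have cancel_x (a b : 'cV[R]_N) : x + a - (x + b) = a - b.
      by rewrite opprD addrACA subrr add0r.
    exact: cancel_x.
  apply: le_trans (H _) _.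
    move=> s s0 st; apply: le_trans (W_dist _ _ _ _) _.
    rewrite lerD ?(ler_wpM2l w0)// ler_pM ?mulr_ge0// ler_wpM2l// hD//.
    exact: le_trans st t1.
  apply: (@le_trans _ _ (L * (4 * w * eta / p) * beta + w * (eta / p))).
    by rewrite ler_piMr.
  rewrite pS.
  have -> : L * (4 * w * eta / p) * beta = 4 * (L * beta) * (w * (eta / p)) by ring.
  have -> : 4 * w * eta / (2 * p) = 2 * (w * (eta / p)) by field; rewrite gt_eqF.
  have := ler_wpM2r (mulr_ge0 w0 e0) small1; lra.
split => //.
have cancel_xy (c e a b : 'cV[R]_N) :
    c + (y - (x + a)) - (e + (y - (x + b))) = - ((a - b) - (c - e)).
  rewrite !(opprD, opprK, addrA).
  by rewrite [LHS](ACl ((2*6)*(3*7)*(4*8)*1*5))/= subrr addNr !add0r.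
have -> : par n.+2 - par n.+1 =
   - ((prim (fun u => W (psi n.+1 u) (par n.+1)) 1 - prim (fun u => W (psi n u) (par n)) 1)
   - (par n.+1 - par n)).
  exact: cancel_xy.
rewrite normrN.
set c := par n.+1 - par n.
have cE z : W z c = W z (par n.+1) - W z (par n) by rewrite Wlin.
have hc : `|c| <= eta / p by [].
clearbody c.
have lc := lipschitz01_cst c.
have lG : lipschitz01 (fun u => W (psi n u) (par n) + c).
  have [K2 hK2] := F2; exists K2 => u v u01 v01; rewrite opprD addrACA subrr addr0.
  exact: hK2.
have c0 : 0 <= L * (w * beta) * (eta / p) + L * (4 * w * eta / p) * beta.
  by rewrite addr_ge0// !mulr_ge0// invr_ge0 ltW.
have := prim_dist F1 lG (lexx 0) ler01 (lexx 1) c0.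
rewrite !prim0 !subr0 primD// prim_cst// scale1r mulr1 opprD addrA => H.
apply: le_trans (H _) _.
  move=> t t0 t1.
  (* The first difference is small because the trajectory stays near x, where the field is the
     identity in c; the second because consecutive trajectories are close. *)
  have -> : W (psi n.+1 t) (par n.+1) - (W (psi n t) (par n) + c) =
     (W (psi n.+1 t) c - W x c) + (W (psi n.+1 t) (par n) - W (psi n t) (par n)).
    rewrite Wx cE.
    set z := W _ (par n.+1); set z1 := W _ (par n); set z2 := W _ (par n).
    by rewrite !(opprD, opprK, addrA) [RHS](ACl ((2*4)*1*5*3))/= addNr add0r.
  apply: le_trans (ler_normD _ _) _; apply: lerD.
    apply: le_trans (Wlip _ _ _) _; rewrite ler_pM ?mulr_ge0// ler_wpM2l//.
    exact: psi_near.
  apply: le_trans (Wlip _ _ _) _; rewrite ler_pM ?mulr_ge0// ler_wpM2l//.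
  exact: hD.
rewrite pS.
have -> : L * (w * beta) * (eta / p) = L * beta * w * (eta / p) by ring.
have -> : L * (4 * w * eta / p) * beta = 4 * (L * beta * w * (eta / p)) by ring.
have -> : eta / (2 * p) = (eta / p) / 2 by field; rewrite gt_eqF.
by have := ler_wpM2r e0 small2; lra.
Qed.

(** The limit solves f' = W(f, b) between x and y. The equation is recorded as a quadratic
    remainder, the form in which it is later compared with sums of primitives and integrated along
    the clock. *)
Lemma steering : exists (f : R -> 'cV[R]_N) (b : 'cV[R]_N),
  [/\ f 0 = x, f 1 = y, `|b| <= beta,
      (forall u v, 0 <= u -> u <= v -> v <= 1 -> `|f v - f u| <= w * beta * (v - u)) &
      forall u v, 0 <= u -> u <= v -> v <= 1 ->
        `|f v - f u - (v - u) *: W (f u) b| <= L * (w * beta) * beta * (v - u) ^+ 2].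
Proof.
have A0 : 0 <= 4 * w * eta by rewrite !mulr_ge0.
have [b hb] := @geometric_limit R N (fun n => par n) eta eta0
  (fun n => (contraction n).2).
(* Outside [0, 1] the iterates are not controlled; there the limit is given the value 0. *)
have lim_psi t : exists l, 0 <= t -> t <= 1 ->
    forall n, `|l - psi n t| <= 2 * (4 * w * eta) / 2 ^+ n.
  have [/andP[t0 t1]|nt] := boolP ((0 <= t) && (t <= 1)).
    have [l hl] := @geometric_limit R N (fun n => psi n t) _ A0
      (fun n => (contraction n).1 t t0 t1).
    by exists l.
  by exists 0 => t0 t1; rewrite t0 t1 in nt.
have [f hf] := choice lim_psi.
pose A := 2 * (4 * w * eta).
have limit (z : 'cV[R]_N) (c K : R) (F : nat -> 'cV[R]_N) :
    (forall n, `|F n| <= c) -> (forall n, `|z - F n| <= K / 2 ^+ n) -> `|z| <= c.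
  move=> Fc FK; apply: (@le_add_half_pow _ _ _ K) => n.
  rewrite -(subrK (F n) z); apply: le_trans (ler_normD _ _) _.
  by rewrite [leLHS]addrC; apply: lerD (Fc n) (FK n).
have b_le : `|b| <= beta by exact: limit par_le hb.
have half_le (K : R) n : 0 <= K -> K / 2 ^+ n.+1 <= K / 2 ^+ n.
  move=> K0; rewrite exprS invfM mulrA ler_wpM2r ?invr_ge0 ?exprn_ge0//.
  by rewrite ler_pdivrMr// ler_peMr// ler1n.
have f0 : f 0 = x.
  apply/eqP; rewrite -subr_eq0 -normr_le0; apply: (@le_add_half_pow _ _ _ A) => n.
  by have [_ h0 _] := invariant n; have := hf 0 (lexx _) ler01 n; rewrite h0 add0r.
have f1 : f 1 = y.
  apply/eqP; rewrite -subr_eq0 -normr_le0.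
  apply: (@le_add_half_pow _ _ _ (A + eta)) => n; rewrite add0r.
  have -> : f 1 - y = (f 1 - psi n.+1 1) - (par n.+1 - par n).
    by rewrite parS [par n + _]addrC addrK opprB subrKA.
  apply: le_trans (ler_normB _ _) _; rewrite mulrDl lerD ?(contraction n).2//.
  by apply: le_trans (hf 1 ler01 (lexx _) n.+1) (half_le _ _ _); rewrite mulr_ge0.
have f_lip u v : 0 <= u -> u <= v -> v <= 1 -> `|f v - f u| <= w * beta * (v - u).
  move=> u0 uv v1; apply: (limit _ _ (A + A) (fun n => psi n v - psi n u)).
    by move=> n; have [_ _ hl] := invariant n; exact: hl.
  move=> n; rewrite opprD addrACA -opprD mulrDl.
  apply: le_trans (ler_normB _ _) _; apply: lerD; apply: hf => //.
  - exact: le_trans uv.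
  - exact: le_trans v1.
exists f, b; split => // u v u0 uv v1.
have v0 := le_trans u0 uv; have u1 := le_trans uv v1.
have A_ge0 : 0 <= A by rewrite mulr_ge0.
have wb0 : 0 <= w * beta by rewrite mulr_ge0// mulr_ge0.
pose F n := psi n.+1 v - psi n.+1 u - (v - u) *: W (psi n u) (par n).
apply: (limit _ _ (A + A + (L * A * beta + w * (2 * eta))) F) => n.
  have e0 : 0 <= L * (w * beta) * beta * (v - u).
    by rewrite mulr_ge0 ?subr_ge0// !mulr_ge0.
  have := @prim_approx _ _ _ u v _ (W (psi n u) (par n))
    (lipschitz_W (par n) (psi_lip n)) u0 uv v1 e0.
  rewrite /F !psiS opprD [x + _ + _]addrACA subrr add0r => approx.
  have -> : L * (w * beta) * beta * (v - u) ^+ 2 = L * (w * beta) * beta * (v - u) * (v - u).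
    by rewrite expr2 [LHS]mulrA.
  apply: approx.
  move=> t ut tv; apply: le_trans (Wlip _ _ _) _.
  rewrite [leRHS]mulrAC ler_pM ?mulr_ge0//.
  rewrite -mulrA ler_wpM2l//; have [_ _ hl] := invariant n.
  apply: le_trans (hl u t u0 ut (le_trans tv v1)) _.
  by rewrite ler_wpM2l// lerB.
have -> : f v - f u - (v - u) *: W (f u) b - F n =
    (f v - psi n.+1 v) - (f u - psi n.+1 u)
    - (v - u) *: (W (f u) b - W (psi n u) (par n)).
  rewrite /F scalerBr; move: (psi n.+1 v) (psi n.+1 u) (f v) (f u) => a1 a2 a3 a4.
  move: ((v - u) *: _) ((v - u) *: _) => a5 a6.
  by rewrite !(opprD, opprK, addrA) [LHS](ACl (1*4*2*5*3*6)).
rewrite (mulrDl (A + A)) (mulrDl A A) (mulrDl (L * A * beta)).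
apply: le_trans (ler_normB _ _) _; apply: lerD.
  apply: le_trans (ler_normB _ _) _; apply: lerD.
    exact: le_trans (hf v v0 v1 n.+1) (half_le _ _ A_ge0).
  exact: le_trans (hf u u0 u1 n.+1) (half_le _ _ A_ge0).
rewrite normrZ ger0_norm ?subr_ge0//.
apply: (@le_trans _ _ `|W (f u) b - W (psi n u) (par n)|).
  by rewrite ler_piMl//; lra.
apply: le_trans (W_dist _ _ _ _) _; apply: lerD; last first.
  by have := ler_wpM2l w0 (hb n); rewrite !mulrA.
rewrite [leRHS]mulrAC ler_pM ?mulr_ge0// -mulrA ler_wpM2l//.
exact: hf.
Qed.

End steering.

(** * Young integrals along a clock *)

(** Bisecting n times leaves 2^n pieces, each contributing 4^(-n) of the bound, for a total of
    2^(-n). *)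
Lemma constant_of_quadratic (R : realType) (N : nat) (D : R -> 'cV[R]_N) (K : R) :
  (forall u v, 0 <= u -> u <= v -> v <= 1 -> `|D v - D u| <= K * (v - u) ^+ 2) ->
  forall t, 0 <= t -> t <= 1 -> D t = D 0.
Proof.
move=> DK t t0 t1.
suff main n u v : 0 <= u -> u <= v -> v <= 1 ->
    `|D v - D u| <= K * (v - u) ^+ 2 / 2 ^+ n.
  apply/eqP; rewrite -subr_eq0 -normr_le0.
  apply: (@le_add_half_pow _ _ _ (K * (t - 0) ^+ 2)) => n; rewrite add0r.
  exact: main.
elim: n u v => [|n IH] u v u0 uv v1; first by rewrite expr0 divr1 DK.
set m := (u + v) / 2.
have um : u <= m by rewrite /m; lra.
have mv : m <= v by rewrite /m; lra.
have h1 := IH u m u0 um (le_trans mv v1).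
have h2 := IH m v (le_trans u0 um) mv v1.
rewrite -(subrKA (D m)); apply: le_trans (ler_normD _ _) _.
apply: le_trans (lerD h2 h1) _.
rewrite le_eqVlt; apply/orP; left; apply/eqP.
by rewrite [2 ^+ n.+1]exprS /m; field; rewrite expf_neq0.
Qed.

Section young_composition.
Context (R : realType) (N : nat) (g : R -> R) (alpha : R).
Hypothesis alpha0 : 0 < alpha.
Hypothesis g01 : forall t, 0 <= t -> t <= 1 -> 0 <= g t <= 1.
Hypothesis g_mono : forall u v, 0 <= u -> u <= v -> v <= 1 -> g u <= g v.
Hypothesis g_hoelder : forall u v, u \in `[0, 1] -> v \in `[0, 1] ->
  `|g v - g u| <= `|v - u| `^ alpha.

Let sub01 (t u : R) : t <= 1 -> u \in `[0, t] -> u \in `[0, 1].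
Proof. by move=> t1; rewrite !in_itv/= => /andP[-> ut]; exact: le_trans t1. Qed.

Let g_in (u : R) : u \in `[0, 1] -> g u \in `[0, 1].
Proof. by rewrite !in_itv/= => /andP[u0 u1]; exact: g01. Qed.

Lemma continuous_comp_clock (U : normedModType R) (F : R -> U) (K t : R) :
  0 <= K -> t <= 1 ->
  (forall u v, u \in `[0, 1] -> v \in `[0, 1] -> `|F v - F u| <= K * `|v - u|) ->
  {within `[0, t], continuous (fun s => F (g s))}.
Proof.
move=> K0 t1 FK; apply: (@hoelder_continuous _ _ _ _ K alpha) => // u v ut vt.
have u1 := sub01 t1 ut; have v1 := sub01 t1 vt.
by apply: le_trans (FK _ _ (g_in u1) (g_in v1)) _; rewrite ler_wpM2l// g_hoelder.
Qed.

(** The increments are dominated by those of the monotone [g], which telescope. This supplies the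
    exponents p = q = 1 in Young's condition. *)
Lemma finite_variation_comp_clock (U : normedModType R) (F : R -> U) (K t : R) :
  0 <= K -> t <= 1 ->
  (forall u v, u \in `[0, 1] -> v \in `[0, 1] -> `|F v - F u| <= K * `|v - u|) ->
  finite_variation 1 0 t (fun s => F (g s)).
Proof.
move=> K0 t1 FK; exists (K * (g t - g 0)) => s ps.
rewrite -(psum_tele g ps) /psum mulr_sumr -/(psum (fun u v => K * (g v - g u)) t 0 s).
apply: (psum_le (F := fun u v => `|F (g v) - F (g u)| `^ 1)) ps => u v u0 uv vt.
have v1 := le_trans vt t1; have u1 := le_trans (ltW uv) v1; have v0 := le_trans u0 (ltW uv).
rewrite powRr1//; apply: le_trans (FK _ _ _ _) _; rewrite ?g_in ?in_itv/= ?u0 ?v0//.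
by rewrite ger0_norm// subr_ge0 g_mono// ltW.
Qed.

(** Substitution rule, [G] being a primitive of [F] up to quadratic remainders. A partition interval
    on which g grows by D contributes an error of order D^2, and the D add up to at most 1. *)
Lemma young_integral_comp (F G : R -> 'cV[R]_N) (K K1 c t : R) :
  0 <= K -> 0 <= K1 -> 0 <= t -> t <= 1 ->
  (forall u v, u \in `[0, 1] -> v \in `[0, 1] -> `|F v - F u| <= K * `|v - u|) ->
  (forall u v, 0 <= u -> u <= v -> v <= 1 ->
     `|G v - G u - (v - u) *: F u| <= K1 * (v - u) ^+ 2) ->
  is_young_integral (fun s => F (g s)) (fun s => c * g s) 0 t
    (c *: (G (g t) - G (g 0))).
Proof.
move=> K0 K10 t0 t1 FK GK.
have cK u v : u \in `[0, 1] -> v \in `[0, 1] -> `|c * v - c * u| <= `|c| * `|v - u|.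
  by move=> _ _; rewrite -mulrBr normrM.
split.
- exact: continuous_comp_clock FK.
- exact: (@continuous_comp_clock R (fun v => c * v) `|c|).
- exists 1, 1; split => //; first by rewrite invr1; lra.
    exact: finite_variation_comp_clock FK.
  exact: (@finite_variation_comp_clock R (fun v => c * v) `|c|).
move=> e e0.
set C := `|c| * (K + K1); have C0 : 0 <= C by rewrite mulr_ge0// addr_ge0.
have r0 : 0 < e / (C + 1) by rewrite divr_gt0// ltr_wpDl.
(* A mesh below this value keeps each increment of [g] below e / (C + 1), by Hoelder continuity. *)
exists ((e / (C + 1)) `^ alpha^-1); first by rewrite powR_gt0.
move=> s xi ps mesh.
pose T k := nth t (0 :: s) k.
have T01 k : (k <= size s)%N -> 0 <= T k <= t.
  move=> ks; rewrite (itv_partition_nth_ge _ ps)//=.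
  by rewrite (itv_partition_nth_le _ ps).
have TE : c *: (G (g t) - G (g 0)) =
    \sum_(0 <= k < size s) c *: (G (g (T k.+1)) - G (g (T k))).
  by rewrite -scaler_sumr -(psum_tele (fun u => G (g u)) ps).
rewrite TE /riemann_sum -sumrB.
apply: le_lt_trans (ler_norm_sum _ _ _) _.
apply: (@le_lt_trans _ _ (\sum_(0 <= k < size s) C * (e / (C + 1)) * (g (T k.+1) - g (T k)))).
  rewrite !big_nat; apply: ler_sum => k /andP[_ ks].
  have [mk /andP[xi1 xi2]] := mesh k ks.
  rewrite -/(T k) -/(T k.+1) in mk xi1 xi2 *.
  have /andP[a0 a1] := T01 k (ltnW ks); have /andP[b0 b1] := T01 k.+1 ks.
  have ab := le_trans xi1 xi2.
  have B1 := le_trans b1 t1; have A1 := le_trans a1 t1.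
  have X0 := le_trans a0 xi1; have X1 := le_trans xi2 B1.
  have a01 : T k \in `[0, 1] by rewrite in_itv/= a0.
  have b01 : T k.+1 \in `[0, 1] by rewrite in_itv/= b0.
  have x01 : xi k \in `[0, 1] by rewrite in_itv/= X0.
  have gab := g_mono a0 ab B1.
  have gax := g_mono a0 xi1 X1; have gxb := g_mono X0 xi2 B1.
  have small : g (T k.+1) - g (T k) <= e / (C + 1).
    apply: le_trans (ler_norm _) _; apply: le_trans (g_hoelder a01 b01) _.
    have -> : e / (C + 1) = ((e / (C + 1)) `^ alpha^-1) `^ alpha.
      by rewrite -powRrM mulVf ?gt_eqF// powRr1// ltW.
    rewrite ge0_ler_powR ?nnegrE ?powR_ge0 ?(ltW alpha0)//.
    by rewrite ger0_norm ?subr_ge0// ltW.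
  set D := g (T k.+1) - g (T k) in small *.
  have D0 : 0 <= D by rewrite subr_ge0.
  have /andP[ga0 _] := g01 a0 A1; have /andP[_ gb1] := g01 b0 B1.
  have -> : (c * g (T k.+1) - c * g (T k)) *: F (g (xi k)) - c *: (G (g (T k.+1)) - G (g (T k)))
    = c *: (D *: (F (g (xi k)) - F (g (T k))) - (G (g (T k.+1)) - G (g (T k)) - D *: F (g (T k)))).
    rewrite -mulrBr -/D -scalerA -scalerBr; congr (_ *: _).
    by rewrite scalerBr [in RHS]opprB [RHS]addrA addrNK.
  have -> : C * (e / (C + 1)) * D = `|c| * ((K + K1) * (e / (C + 1) * D)).
    by rewrite {1}/C -!mulrA.
  rewrite normrZ ler_wpM2l//.
  apply: (@le_trans _ _ ((K + K1) * (D * D))); last first.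
    by rewrite ler_wpM2l ?addr_ge0// ler_wpM2r.
  apply: le_trans (ler_normB _ _) _; rewrite mulrDl; apply: lerD.
    rewrite normrZ (ger0_norm D0) mulrCA ler_wpM2l//.
    apply: le_trans (FK _ _ (g_in a01) (g_in x01)) _; rewrite ler_wpM2l//.
    by rewrite ger0_norm ?subr_ge0// lerB.
  by rewrite -expr2; exact: GK.
rewrite -mulr_sumr (_ : \sum_(0 <= k < size s) _ = g t - g 0); last first.
  exact: (psum_tele g ps).
have /andP[_ gt1] := g01 t0 t1; have /andP[g00 _] := g01 (lexx 0) ler01.
apply: (@le_lt_trans _ _ (C * (e / (C + 1)))).
  have p0 : 0 <= C * (e / (C + 1)) by apply: mulr_ge0 => //; exact: ltW.
  have d1 : g t - g 0 <= 1 by lra.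
  exact: ler_piMr.
by rewrite mulrCA gtr_pMr// ltr_pdivrMr ?mul1r ?ltrDl// ltr_wpDl.
Qed.

End young_composition.

(** * Smooth vector fields and ellipticity *)

Section lipschitz_of_partials.
Context (R : realType) (N : nat) (W : 'cV[R]_N -> 'cV[R]_N).

Lemma derive_along_line (x v : 'cV[R]_N) (k : 'I_N) (s : R) :
  derivable W (x + s *: v) v ->
  is_derive s (1 : R) (fun u : R => W (x + u *: v) k 0) (('D_v W (x + s *: v)) k 0).
Proof.
move=> dW.
have H : (fun h : R => h^-1 *: (((fun u : R => W (x + u *: v) k 0) \o shift s) (h *: (1 : R))
    - W (x + s *: v) k 0)) @ 0^' --> ('D_v W (x + s *: v)) k 0.
  have dW' : (fun h : R => h^-1 *: ((W \o shift (x + s *: v)) (h *: v) - W (x + s *: v)))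
      @ 0^' --> 'D_v W (x + s *: v) by exact: dW.
  have := cvg_comp _ _ dW' (@coord_continuous R N 1 k 0 ('D_v W (x + s *: v))).
  apply: cvg_trans; apply: near_eq_cvg; near=> h.
  rewrite /= !mxE /=; congr (_ * (W _ k 0 - _)).
  by rewrite scalerDl addrCA /GRing.scale/= mulr1.
by split; [apply/cvg_ex; eexists; exact: H|apply/cvg_lim => //; exact: H].
Unshelve. all: by end_near. Qed.

Lemma partial_lipschitz (i : 'I_N) (M : R) :
  (forall x, derivable W x (delta_mx i 0)) ->
  (forall x, `|'D_(delta_mx i 0) W x| <= M) ->
  forall x (t : R), `|W (x + t *: delta_mx i 0) - W x| <= M * `|t|.
Proof.
move=> dW DM.
have M0 : 0 <= M by apply: le_trans (DM 0).
have pos x t : 0 <= t -> `|W (x + t *: delta_mx i 0) - W x| <= M * t.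
  move=> t0; apply: norm_le_coord => [|k]; first by rewrite mulr_ge0.
  pose phi (u : R) := W (x + u *: delta_mx i 0) k 0.
  have dphi s : is_derive s (1 : R) phi (('D_(delta_mx i 0) W (x + s *: delta_mx i 0)) k 0).
    exact: derive_along_line.
  have cphi : {within `[0, t], continuous phi}.
    apply: continuous_subspaceT => s; apply: differentiable_continuous.
    by apply/derivable1_diffP; case: (dphi s).
  have [c _ E] := MVT_segment t0 (fun s _ => dphi s) cphi.
  have p0 : phi 0 = W x k 0 by rewrite /phi scale0r addr0.
  rewrite !mxE -p0 [X in `|X|]E subr0 normrM (ger0_norm t0) ler_wpM2r//.
  exact: le_trans (norm_coord _ _) (DM _).
move=> x t; have [t0|/ltW t0] := leP 0 t; first by rewrite (ger0_norm t0) pos.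
have := pos (x + t *: delta_mx i 0) (- t); rewrite oppr_ge0 => /(_ t0).
by rewrite scaleNr addrK distrC (ler0_norm t0).
Qed.

(** [smooth_bounded] speaks of partial derivatives only, so x is joined to y by changing one
    coordinate at a time, with the mean value theorem on each segment. *)
Lemma lipschitz_of_partials (M : R) :
  (forall x i, derivable W x (delta_mx i 0)) ->
  (forall x i, `|'D_(delta_mx i 0) W x| <= M) ->
  forall x y, `|W y - W x| <= N%:R * M * `|y - x|.
Proof.
move=> dW DM x y.
pose z m : 'cV[R]_N := \col_j (if (j < m)%N then y j 0 else x j 0).
have zN : z N = y by apply/colP => j; rewrite mxE ltn_ord.
have z0 : z 0%N = x by apply/colP => j; rewrite mxE ltn0.
have step (m : 'I_N) : `|W (z m.+1) - W (z m)| <= M * `|y - x|.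
  have -> : z m.+1 = z m + (y m 0 - x m 0) *: delta_mx m 0.
    apply/colP => j; rewrite !mxE ltnS leq_eqVlt andbT.
    have [->|jm] := eqVneq j m; first by rewrite eqxx ltnn/= mulr1 addrC subrK.
    by rewrite (negbTE (jm : (j : nat) != m)) mulr0 addr0.
  apply: le_trans (partial_lipschitz _ _ _ _) _ => [x'|x'|]; [exact: dW|exact: DM|].
  rewrite ler_wpM2l//; first by apply: le_trans (DM 0 m).
  by have := norm_coord (y - x) m; rewrite !mxE.
have -> : W y - W x = \sum_(i < N) (W (z i.+1) - W (z i)).
  rewrite -(big_mkord xpredT (fun m => W (z m.+1) - W (z m))).
  by rewrite (telescope_sumr (fun m => W (z m)))// zN z0.
apply: le_trans (ler_norm_sum _ _ _) _.
have -> : N%:R * M * `|y - x| = \sum_(i < N) M * `|y - x|.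
  by rewrite sumr_const card_ord -mulrA mulr_natl.
by apply: ler_sum.
Qed.

End lipschitz_of_partials.

Lemma smooth_bounded_lipschitz (R : realType) (N : nat) (W : 'cV[R]_N -> 'cV[R]_N) :
  smooth_bounded W -> exists M L : R, [/\ 0 <= M, 0 <= L,
    forall z, `|W z| <= M & forall z z', `|W z - W z'| <= L * `|z - z'|].
Proof.
move=> sb; have [dW _ [M WM]] := sb [::].
have M0 : 0 <= M by apply: le_trans (WM 0); exact: sqrtr_ge0.
have /choice[D hD] (i : 'I_N) : exists K, forall x, enorm ('D_(delta_mx i 0) W x) <= K.
  by have [_ _] := sb [:: i].
pose K := \sum_i `|D i|.
have K0 : 0 <= K by exact: sumr_ge0.
exists M, (N%:R * K); split => //; first by rewrite mulr_ge0.
  by move=> z; apply: le_trans (norm_le_enorm _) (WM z).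
move=> z z'; apply: lipschitz_of_partials => // x i.
apply: le_trans (norm_le_enorm _) _; apply: le_trans (hD i x) _.
apply: le_trans (ler_norm _) _; rewrite /K (bigD1 i)//= lerDl.
exact: sumr_ge0.
Qed.

Lemma smooth_bounded_family (R : realType) (N d : nat)
    (V : 'I_d -> 'cV[R]_N -> 'cV[R]_N) :
  (forall i, smooth_bounded (V i)) -> exists M L : R, [/\ 0 <= M, 0 <= L,
    forall i z, `|V i z| <= M &
    forall i z z', `|V i z - V i z'| <= L * `|z - z'|].
Proof.
move=> sV.
have /choice[M /choice[L ML]] := fun i => smooth_bounded_lipschitz (sV i).
have M0 i : 0 <= M i by case: (ML i).
have L0 i : 0 <= L i by case: (ML i).
exists (\sum_i M i), (\sum_i L i); split; [exact: sumr_ge0..| |] => i z.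
  case: (ML i) => _ _ VM _; apply: le_trans (VM z) _.
  by rewrite (bigD1 i)//= lerDl sumr_ge0.
move=> z'; case: (ML i) => _ _ _ VL; apply: le_trans (VL z z') _.
by rewrite ler_wpM2r// (bigD1 i)//= lerDl sumr_ge0.
Qed.

Section ellipticity.
Context (R : realType) (N d : nat) (F : 'M[R]_(N, d)) (lam : R).
Hypothesis lam0 : 0 < lam.
Hypothesis F_elliptic : forall xi : 'cV[R]_N,
  lam * enorm xi ^+ 2 <= (xi^T *m F *m F^T *m xi) 0 0.

Lemma enorm_sqr (n : nat) (v : 'cV[R]_n) : enorm v ^+ 2 = (v^T *m v) 0 0.
Proof.
rewrite sqr_sqrtr; last by apply: sumr_ge0 => k _; exact: sqr_ge0.
by rewrite mxE; apply: eq_bigr => k _; rewrite mxE expr2.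
Qed.

Lemma elliptic_unitmx : F *m F^T \in unitmx.
Proof.
rewrite -row_free_unit -kermx_eq0; apply/rowV0P => v /sub_kermxP vA0.
have := F_elliptic v^T; rewrite trmxK -(mulmxA v) vA0 mul0mx mxE.
rewrite pmulr_rle0// => h.
have := norm_le_enorm v^T.
have e0 : enorm v^T = 0.
  by apply/eqP; rewrite -sqrf_eq0 eq_le h sqr_ge0.
by rewrite e0 normr_le0 => /eqP /(congr1 trmx); rewrite trmxK trmx0.
Qed.

(** The Moore-Penrose inverse of [F], which has full row rank by ellipticity. *)
Definition right_inverse : 'M[R]_(d, N) := F^T *m invmx (F *m F^T).

Lemma right_inverseK : F *m right_inverse = 1%:M.
Proof. by rewrite mulmxA mulmxV// elliptic_unitmx. Qed.

(** With z = (F F^T)^(-1) v, the squared norm of the left side is z . v, at most lam |z|^2 / 2 +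
    |v|^2 / (2 lam); ellipticity bounds lam |z|^2 by that squared norm, so half of it is
    absorbed. *)
Lemma right_inverse_bound (v : 'cV[R]_N) :
  enorm (right_inverse *m v) <= enorm v / Num.sqrt lam.
Proof.
have s0 : 0 < Num.sqrt lam by rewrite sqrtr_gt0.
have e0 n (u : 'cV[R]_n) : 0 <= enorm u by exact: sqrtr_ge0.
rewrite -(@ler_pXn2r _ 2)// ?nnegrE// ?divr_ge0// ?(ltW s0)//.
rewrite expr_div_n (sqr_sqrtr (ltW lam0)).
set z := invmx (F *m F^T) *m v.
have Az : F *m F^T *m z = v by rewrite mulmxA mulmxV ?elliptic_unitmx// mul1mx.
have QE : right_inverse *m v = F^T *m z by rewrite /right_inverse -mulmxA.
have E1 : enorm (right_inverse *m v) ^+ 2 = (z^T *m v) 0 0.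
  by rewrite enorm_sqr QE trmx_mul trmxK mulmxA -(mulmxA z^T) -mulmxA Az.
have E2 : lam * enorm z ^+ 2 <= enorm (right_inverse *m v) ^+ 2.
  by apply: le_trans (F_elliptic z) _; rewrite E1 -(mulmxA z^T) -mulmxA Az.
clearbody z.
have E3 : (z^T *m v) 0 0 <= 2^-1 * (lam * enorm z ^+ 2) + 2^-1 * (enorm v ^+ 2 / lam).
  rewrite !enorm_sqr !mxE !mulr_sumr mulr_suml mulr_sumr -big_split/=.
  apply: ler_sum => k _; rewrite !mxE.
  have : 0 <= (lam * z k 0 - v k 0) ^+ 2 / lam by rewrite divr_ge0 ?sqr_ge0 ?ltW.
  have -> : (lam * z k 0 - v k 0) ^+ 2 / lam =
    lam * (z k 0 * z k 0) - 2 * (z k 0 * v k 0) + v k 0 * v k 0 / lam.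
    by field; rewrite gt_eqF.
  lra.
lra.
Qed.

End ellipticity.

(** * The two bounds *)

(** Abstracts E(B_t B_1), so that solutions along it are built without reference to the process. *)
Definition clock (R : realType) (g : R -> R) (alpha : R) : Prop :=
  [/\ 0 < alpha, g 0 = 0, g 1 = 1,
      forall u v, 0 <= u -> u <= v -> v <= 1 -> g u <= g v &
      forall u v, u \in `[0, 1] -> v \in `[0, 1] -> `|g v - g u| <= `|v - u| `^ alpha].

Section upper_bound_solution.
Context (R : realType) (N d : nat) (V : 'I_d -> 'cV[R]_N -> 'cV[R]_N).
Context (M L lam : R) (g : R -> R) (alpha : R).
Hypothesis M0 : 0 <= M.
Hypothesis L0 : 0 <= L.
Hypothesis VM : forall i z, `|V i z| <= M.
Hypothesis VL : forall i z1 z2, `|V i z1 - V i z2| <= L * `|z1 - z2|.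
Hypothesis lam0 : 0 < lam.
Hypothesis V_elliptic : forall x xi : 'cV[R]_N, lam * enorm xi ^+ 2
  <= (xi^T *m field_matrix V x *m (field_matrix V x)^T *m xi) 0 0.
Hypothesis g_clock : clock g alpha.

Let kappa := N%:R / Num.sqrt lam.
Let w := d%:R * M * kappa.
Let Lw := d%:R * L * kappa.

(** The factor 20 is such that 2 |y - x| Lw w <= 1/10, the second smallness condition of [steering];
    the first one follows with room to spare. *)
Lemma steering_solution (x y : 'cV[R]_N) :
  `|y - x| <= (20 * (Lw + 1) * (w + 1))^-1 ->
  exists (a : 'cV[R]_d) (phi : R -> 'cV[R]_N),
    [/\ enorm a <= kappa * (2 * `|y - x|),
        is_young_solution V (fun i t => a i 0 * g t) x phi & phi 1 = y].
Proof.
have [al0 g0 g1 g_mono g_hoelder] := g_clock.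
have g01 t : 0 <= t -> t <= 1 -> 0 <= g t <= 1.
  by move=> t0 t1; rewrite -{1}g0 -g1 !g_mono.
have sl0 : 0 < Num.sqrt lam by rewrite sqrtr_gt0.
have k0 : 0 <= kappa by rewrite divr_ge0// ltW.
have w0 : 0 <= w by rewrite !mulr_ge0.
have Lw0 : 0 <= Lw by rewrite !mulr_ge0.
move=> small; set Q := right_inverse (field_matrix V x).
have Qb (b : 'cV[R]_N) : enorm (Q *m b) <= kappa * `|b|.
  apply: le_trans (right_inverse_bound lam0 (V_elliptic x) b) _.
  by rewrite mulrAC ler_wpM2r ?invr_ge0 ?(ltW sl0)// enorm_le_norm.
(* The parameter b is the desired velocity at x, and Q b are the coefficients of the fields that
   realize it there. *)
pose W (z b : 'cV[R]_N) := \sum_i (Q *m b) i 0 *: V i z.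
have Qi (b : 'cV[R]_N) i : `|(Q *m b) i 0| <= kappa * `|b|.
  exact: le_trans (le_trans (norm_coord (Q *m b) i) (norm_le_enorm _)) (Qb b).
have sum_cst (c : R) : \sum_(i < d) c = d%:R * c.
  by rewrite sumr_const card_ord mulr_natl.
have Wlin z b b' : W z (b - b') = W z b - W z b'.
  rewrite -sumrB; apply: eq_bigr => i _.
  by rewrite mulmxBr !mxE -scalerBl.
have Wbound z b : `|W z b| <= w * `|b|.
  apply: le_trans (ler_norm_sum _ _ _) _.
  have -> : w * `|b| = d%:R * ((kappa * `|b|) * M) by rewrite /w; ring.
  by rewrite -sum_cst; apply: ler_sum => i _; rewrite normrZ ler_pM.
have Wlip z z' b : `|W z b - W z' b| <= Lw * `|z - z'| * `|b|.
  rewrite -sumrB; apply: le_trans (ler_norm_sum _ _ _) _.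
  have -> : Lw * `|z - z'| * `|b| = d%:R * ((kappa * `|b|) * (L * `|z - z'|)).
    by rewrite /Lw; ring.
  by rewrite -sum_cst; apply: ler_sum => i _; rewrite -scalerBr normrZ ler_pM.
have Wx b : W x b = b.
  have -> : W x b = field_matrix V x *m (Q *m b).
    apply/colP => k; rewrite summxE mxE; apply: eq_bigr => i _.
    by rewrite [field_matrix _ _ _ _]mxE !mxE mulrC.
  by rewrite mulmxA (right_inverseK lam0 (V_elliptic x)) mul1mx.
have D0 : 0 < 20 * (Lw + 1) * (w + 1) by rewrite !mulr_gt0// ltr_wpDl.
have eD : `|y - x| * (20 * (Lw + 1) * (w + 1)) <= 1.
  by rewrite -ler_pdivlMr// mul1r.
have eta0 := normr_ge0 (y - x).
have e1 : 0 <= `|y - x| * Lw by rewrite mulr_ge0.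
have e2 : 0 <= `|y - x| * w by rewrite mulr_ge0.
have e3 : 0 <= `|y - x| * Lw * w by rewrite mulr_ge0.
have eD' : `|y - x| * (20 * (Lw + 1) * (w + 1)) =
   20 * (`|y - x| * Lw * w) + 20 * (`|y - x| * Lw) + 20 * (`|y - x| * w) + 20 * `|y - x|.
  by ring.
rewrite eD' in eD.
have small1 : Lw * (2 * `|y - x|) <= 4^-1.
  by have -> : Lw * (2 * `|y - x|) = 2 * (`|y - x| * Lw); [ring|lra].
have small2 : Lw * (2 * `|y - x|) * w <= 10^-1.
  by have -> : Lw * (2 * `|y - x|) * w = 2 * (`|y - x| * Lw * w); [ring|lra].
have [f [b [f0 f1 hb f_lip f_quad]]] :=
  steering Lw0 w0 Wlin Wbound Wlip Wx small1 small2.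
set K := w * (2 * `|y - x|) in f_lip f_quad.
have K0 : 0 <= K by rewrite !mulr_ge0.
have fK := lipschitz01_of_increments f_lip.
set a := Q *m b.
pose F i u := V i (f u).
have FK i u v : u \in `[0, 1] -> v \in `[0, 1] -> `|F i v - F i u| <= L * K * `|v - u|.
  move=> u01 v01; apply: le_trans (VL _ _ _) _.
  by rewrite -mulrA ler_wpM2l// fK.
have F_lip i : lipschitz01 (F i) by exists (L * K); exact: FK.
pose G i := prim (F i).
have GK i u v : 0 <= u -> u <= v -> v <= 1 ->
    `|G i v - G i u - (v - u) *: F i u| <= L * K * (v - u) ^+ 2.
  move=> u0 uv v1; rewrite expr2 [leRHS]mulrA; apply: prim_approx => //.
    by rewrite mulr_ge0 ?subr_ge0// mulr_ge0.
  move=> t ut tv; apply: le_trans (FK i u t _ _) _; rewrite ?in_itv/=.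
  - by rewrite u0 (le_trans uv).
  - by rewrite (le_trans u0 ut) (le_trans tv).
  - by rewrite ler_wpM2l ?mulr_ge0// ger0_norm ?subr_ge0// lerB.
have LK0 : 0 <= L * K by rewrite mulr_ge0.
(* Both [f] and the sum of primitives follow the same field up to quadratic errors, so their
   difference is constant: this is the integral equation for [f]. *)
pose D u := f u - \sum_i a i 0 *: G i u.
have D_const t : 0 <= t -> t <= 1 -> D t = D 0.
  apply: (@constant_of_quadratic _ _ _
    (Lw * K * (2 * `|y - x|) + \sum_i `|a i 0| * (L * K))) => u v u0 uv v1.
  have -> : D v - D u = (f v - f u - (v - u) *: W (f u) b)
     - \sum_i a i 0 *: (G i v - G i u - (v - u) *: F i u).
    have -> : \sum_i a i 0 *: (G i v - G i u - (v - u) *: F i u) =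
       \sum_i a i 0 *: G i v - \sum_i a i 0 *: G i u - (v - u) *: W (f u) b.
      rewrite /W scaler_sumr -!sumrB; apply: eq_bigr => i _.
      by rewrite !scalerBr; congr (_ - _); rewrite !scalerA mulrC.
    rewrite /D; move: (\sum_i _) (\sum_i _) ((v - u) *: _) => s1 s2 s3.
    rewrite !(opprD, opprK, addrA) [RHS](ACl ((3*6)*1*4*2*5))/= addNr add0r.
    by [].
  apply: le_trans (ler_normB _ _) _; rewrite mulrDl; apply: lerD; first exact: f_quad.
  apply: le_trans (ler_norm_sum _ _ _) _; rewrite mulr_suml; apply: ler_sum => i _.
  by rewrite normrZ -mulrA ler_wpM2l// GK.
have fE t : 0 <= t -> t <= 1 -> f t = x + \sum_i a i 0 *: G i t.
  move=> t0 t1; have := D_const t t0 t1; rewrite /D f0.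
  have -> : \sum_i a i 0 *: G i 0 = 0.
    by apply: big1 => i _; rewrite /G prim0 scaler0.
  by rewrite subr0 => <-; rewrite subrK.
exists a, (fun s => f (g s)); split; last by rewrite g1.
  by apply: le_trans (Qb b) _; rewrite ler_wpM2l.
split.
- by rewrite g0.
- exact: (continuous_comp_clock al0 g01 g_hoelder K0 (lexx 1) fK).
- exists 1; split; first by rewrite lexx ltr1n.
  exact: (finite_variation_comp_clock g01 g_mono K0 (lexx 1) fK).
- move=> t; rewrite in_itv/= => /andP[t0 t1].
  exists (fun i => a i 0 *: (G i (g t) - G i (g 0))); split.
    move=> i; exact: (young_integral_comp al0 g01 g_mono g_hoelder (a i 0)
      LK0 LK0 t0 t1 (FK i) (GK i)).
  have /andP[gt0 gt1] := g01 t t0 t1.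
  rewrite fE//; congr (_ + _); apply: eq_bigr => i _.
  by rewrite g0 /G prim0 subr0.
Qed.

End upper_bound_solution.

(** * The clock E(B_t B_1) and the Cameron-Martin norm of its multiples *)

Section fbm_clock.
Context (disp : measure_display) (T : measurableType disp) (R : realType).
Context (P : probability T R) (H : R) (d : nat).
Context (B : 'I_d -> R -> {mfun T >-> R}).
Hypothesis H01 : 0 < H < 1.
Hypothesis B_fBm : is_fBm P H B.

(** All components share one covariance, hence one clock. It is monotone because t^(2H) and -(1 -
    t)^(2H) are, and its Hoelder constant 1 is the norm of B_1. *)
Lemma fbm_clock_exists : exists (g : R -> R) (alpha : R), clock g alpha /\
  forall i (t : R), t \in `[0, 1] -> g t = ip P (B i t) (B i 1).
Proof.
have [H0 H1] := andP H01.
(* For d = 0 there is no component to take the covariance from, and the identity serves as clock. *)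
have [i _|noi] := pickP (fun i : 'I_d => true); last first.
  exists id, 1; split; last by move=> i; have := noi i.
  by split => // u v _ _; rewrite powRr1.
have one01 : (1 : R) \in `[0, 1] by rewrite in_itv/= ler01 lexx.
pose g t : R := 2^-1 * (t `^ (2 * H) + 1 - `|t - 1| `^ (2 * H)).
have r0 : 0 < 2 * H by lra.
have gE j t : t \in `[0, 1] -> g t = ip P (B j t) (B j 1).
  move=> t01; rewrite (fbm_ip (H := H))//; last exact: fbm_cov.
  by rewrite powR1.
exists g, H; split => //; split => //.
- by rewrite /g powR0 ?gt_eqF// sub0r normrN normr1 powR1; lra.
- by rewrite /g subrr normr0 powR0 ?gt_eqF// powR1; lra.
- move=> u v u0 uv v1; rewrite /g ler_wpM2l//.
  rewrite !ler0_norm ?subr_le0 ?(le_trans uv)// !opprB.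
  have h1 : u `^ (2 * H) <= v `^ (2 * H).
    by rewrite ge0_ler_powR ?nnegrE ?(ltW r0)// (le_trans u0).
  have h2 : (1 - v) `^ (2 * H) <= (1 - u) `^ (2 * H).
    by rewrite ge0_ler_powR ?nnegrE ?(ltW r0) ?subr_ge0 ?(le_trans uv)// lerB.
  lra.
- move=> u v u01 v01.
  have Zm : ip P (B i 1) (B i 1) <= 1 ^+ 2.
    by rewrite -gE// /g subrr normr0 powR0 ?gt_eqF// powR1; lra.
  have := cm_hoelder H01 (fbm_cov B_fBm i) (fbm_L2 (fbm_cov B_fBm i) one01)
    (gE i) ler01 Zm u01 v01.
  by rewrite mul1r.
Qed.

(** The variable a_i B_1 represents the i-th component and has norm |a_i|; [cm_rep_le] transfers
    this bound to the representative that [cm_norm] actually uses. *)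
Lemma cm_scaled_clock (g : R -> R) (a : 'cV[R]_d) :
  g 1 = 1 -> (forall i (t : R), t \in `[0, 1] -> g t = ip P (B i t) (B i 1)) ->
  cm_space P B (fun i t => a i 0 * g t) /\
  cm_norm P B (fun i t => a i 0 * g t) <= enorm a.
Proof.
move=> g1 gE; have one01 : (1 : R) \in `[0, 1] by rewrite in_itv/= ler01 lexx.
have BL2 i t : t \in `[0, 1] -> L2 P (B i t).
  by move=> t01; apply: (fbm_L2 (fbm_cov B_fBm i)).
have WL2 i : L2 P (a i 0 *: (B i 1 : T -> R)) by apply/L2Z/BL2.
have rep i : cm_represents P (B i) (fun t => a i 0 * g t) (a i 0 *: B i 1).
  split; last first.
    move=> t t01; rewrite (gE i t t01).
    have -> : 'E_P[(B i t \* (a i 0 *: B i 1 : {mfun T >-> R}))%R]%E =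
       (ip P (B i t) (a i 0 *: (B i 1 : T -> R)))%:E by rewrite -ip_fin//; exact: BL2.
    by rewrite (ipC P (B i t) (_ *: _)) ipZl 1?ipC//; exact: BL2.
  split; first exact: WL2.
  (* The variable is itself a one-term combination, so the approximation error is 0. *)
  move=> e e0; exists 1%N, (fun=> a i 0), (fun=> 1); split => //.
  rewrite big_ord1.
  rewrite (_ : _ \o _ = cst 0%E) ?Lnorm0 ?lte_fin//; last first.
    by apply/funext => t; rewrite /= subrr.
have sp : cm_space P B (fun i t => a i 0 * g t).
  by move=> i; exists (a i 0 *: B i 1).
split => //.
rewrite /cm_norm /enorm ler_wsqrtr//; apply: ler_sum => i _.
have repZ := cm_rep_represents i sp.
set Z := cm_rep _ _ _ in repZ.
rewrite /cm_inner1 -/Z.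
have le_ip : ip P Z Z <= ip P (a i 0 *: (B i 1 : T -> R)) (a i 0 *: (B i 1 : T -> R)).
  apply: (cm_rep_le (fbm_cov B_fBm i) repZ.1 (WL2 i)).
  move=> t t01; rewrite -(cm_represents_ip repZ t01) (gE i t t01).
  by rewrite (ipC P (B i t) (_ *: _)) ipZl 1?ipC//; exact: BL2.
apply: le_trans le_ip _; have B1 := BL2 i 1 one01.
rewrite ipZl// (ipC _ _ (_ *: _)) ipZl// -gE// g1; lra.
Qed.

End fbm_clock.

Theorem theorem1p1 (R : realType) (disp : measure_display)
    (T : measurableType disp) (P : probability T R) (H : R)
    (H_range : 4^-1 < H < 1) (N d : nat)
    (B : 'I_d -> R -> {mfun T >-> R}) (B_fBm : is_fBm P H B)
    (V : 'I_d -> 'cV[R]_N -> 'cV[R]_N)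
    (V_smooth : forall i, smooth_bounded (V i))
    (Lambda1 Lambda2 : R) (Lambda1_gt0 : 0 < Lambda1)
    (Lambda2_gt0 : 0 < Lambda2)
    (V_elliptic : forall x xi : 'cV[R]_N,
       Lambda1 * enorm xi ^+ 2
         <= (xi^T *m field_matrix V x *m (field_matrix V x)^T *m xi) 0 0
         <= Lambda2 * enorm xi ^+ 2) :
  exists C delta : R, [/\ 0 < C, 0 < delta &
    forall x y : 'cV[R]_N, enorm (x - y) < delta ->
      ((C^-1 * enorm (x - y))%:E <= control_distance P B V x y
         <= (C * enorm (x - y))%:E)%E].
Proof.
have H01 : 0 < H < 1 by case/andP: H_range => h1 ->; rewrite andbT; lra.
have lower x xi : Lambda1 * enorm xi ^+ 2
    <= (xi^T *m field_matrix V x *m (field_matrix V x)^T *m xi) 0 0.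
  by case/andP: (V_elliptic x xi).
have [M [L [M0 L0 VM VL]]] := smooth_bounded_family V_smooth.
have [K [eps [K0 eps0 disp_le]]] := solution_displacement H01 B_fBm M0 L0 VM VL.
have [g [alpha [g_clock gE]]] := fbm_clock_exists H01 B_fBm.
have g1 : g 1 = 1 by case: g_clock.
set kappa : R := N%:R / Num.sqrt Lambda1.
have k0 : 0 <= kappa by rewrite divr_ge0// sqrtr_ge0.
set delta1 : R := (20 * (d%:R * L * kappa + 1) * (d%:R * M * kappa + 1))^-1.
have d10 : 0 < delta1.
  by rewrite invr_gt0 !mulr_gt0// ltr_wpDl// !mulr_ge0.
have NK0 : 0 <= N%:R * K by rewrite mulr_ge0.
(* The summand 1 serves the paths of large norm, N K the lower bound for small ones, and 2 kappa the
   upper bound. *)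
set C := 1 + N%:R * K + 2 * kappa.
have C1 : 1 <= C by rewrite /C; lra.
have C0 : 0 < C by lra.
exists C, (Num.min eps delta1); split => //; first by rewrite lt_min eps0.
move=> x y; rewrite lt_min => /andP[xy_eps xy_delta].
have exy0 : 0 <= enorm (x - y) by exact: sqrtr_ge0.
have xy_le : `|y - x| <= enorm (x - y) by rewrite distrC norm_le_enorm.
apply/andP; split.
  apply: le_ereal_inf_tmp => _ [h [hB [phi [sol phi1]]] <-]; rewrite lee_fin.
  rewrite mulrC ler_pdivrMr//.
  have n0 : 0 <= cm_norm P B h by exact: sqrtr_ge0.
  (* Only short paths need the displacement estimate; a path of norm at least [eps] is already
     longer than |x - y|. *)
  have [small|big] := ltP (cm_norm P B h) eps.
    have := disp_le h x phi hB sol small; rewrite phi1 distrC => hK.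
    apply: le_trans (enorm_le_norm _) _.
    apply: le_trans (ler_wpM2l (ler0n _ N) hK) _.
    rewrite mulrA mulrC ler_wpM2l// /C; lra.
  apply: (@le_trans _ _ (cm_norm P B h)); first exact: le_trans (ltW xy_eps) big.
  by rewrite ler_peMr.
have [a [phi [a_le sol phi1]]] := steering_solution M0 L0 VM VL Lambda1_gt0
  lower g_clock (le_trans xy_le (ltW xy_delta)).
have [hB h_le] := cm_scaled_clock B_fBm a g1 gE.
apply: (@le_trans _ _ (cm_norm P B (fun i t => a i 0 * g t))%:E).
  by apply: ereal_inf_lbound; exists (fun i t => a i 0 * g t) => //; split => //; exists phi.
rewrite lee_fin; apply: le_trans h_le _; apply: le_trans a_le _.
rewrite mulrA -/kappa; apply: ler_pM => //; first exact: mulr_ge0.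
by rewrite /C; lra.
Qed.
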